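(* For each $n\in\mathbb N$ let $\mathbf d^{(n)}=(d^{(n)}_k)_{k=1,\dots,n}$ be $\mathbb N_0$-valued with $N^{(n)}=\sum_kd_k^{(n)}$ even and positive. Let $D_n$ have law $\frac1n\sum_{k=1}^n\delta_{d_k^{(n)}}$ and $D_n^*$ have law $\frac1{N^{(n)}}\sum_{k=1}^nd_k^{(n)}\delta_{d_k^{(n)}}$, and suppose $\liminf_{n\to\infty}\mathbb E[D_n]>0$. Let $(\ell_n)$ be $\mathbb N$-valued with $\ell_n=o\bigl(\sqrt n\,\mathbb E[D_n^*\wedge\sqrt n]^{-1}\bigr)$. Let $\bar G_n$ be the random graph with fixed degree sequence $\mathbf d^{(n)}$, with a root $\bar o_n$ chosen independently and uniformly from $\{1,\dots,n\}$, and let $G_n^{o_n}$ be a $\mathrm{GWP}(D_n,D_n^* )$-tree. Then for every sequence $(K_n)$ of exploration rules one can couple the $\ell_n$-step $K_n$-explorations of $\bar G_n^{\bar o_n}$ and of $G_n^{o_n}$ such that they agree with probability tending to one as $n\to\infty$.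
   Context: The random graph with fixed degree sequence $\mathbf d^{(n)}$: take half-edges $\mathbb H_n=\bigcup_{j=1}^n\{j\}\times\{1,\dots,d_j^{(n)}\}$, pair them uniformly at random, and let $\bar G_n$ be the multigraph on $\{1,\dots,n\}$ with one edge between $j_1$ and $j_2$ for each pair $\langle(j_1,r_1),(j_2,r_2)\rangle$ (loops and multi-edges allowed). A $\mathrm{GWP}(D,D^* )$-tree (for $\mathbb N_0$-valued $D$ and $\mathbb N$-valued $D^*$) is a random rooted tree where the root has a $D$-distributed number of children and every other vertex independently has a $(D^*-1)$-distributed number of children. Graphs are regarded as rooted multigraphs whose weights are determined by the multigraph structure. Generalised graphs allow edges with one endpoint equal to a cemetery $\partial$; for finite $V_0$, the $V_0$-disclosed subgraph has vertex set $V_0$ and all edges with an endpoint in $V_0$, other endpoints replaced by $\partial$. An exploration is a finite rooted generalised graph with a finite sequence of its edges; an exploration rule $K$ is an isomorphism-invariant probability kernel from explorations to edges (possibly ''no edge''). The $K$-exploration of a rooted graph starts from the $\{\text{root}\}$-disclosed subgraph and at step $k$ draws $e_k\sim K(\mathfrak E_{k-1},\cdot)$, adds the endpoints of $e_k$ to the disclosed set, and records $e_k$. Two explorations agree if an isomorphism of rooted generalised multigraphs maps one to the other including the edge sequences. *)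

(* Defs.v *)
From HB Require Import structures.
From mathcomp Require Import all_boot all_order all_algebra.
From mathcomp Require Import boolp reals.
Set Implicit Arguments. Unset Strict Implicit. Unset Printing Implicit Defensive.
Import Order.TTheory GRing.Theory Num.Theory.
Local Open Scope ring_scope.

(* An exploration is a triple (nv, E, s):                              *)
(*  - vertices 0, ..., nv-1 (the disclosed set), the root is vertex 0; *)
(*  - E : the list of edges of the generalised multigraph, each edge   *)
(*    being an (unordered) pair of endpoints, an endpoint being        *)
(*    [Some v] (a vertex) or [None] (the cemetery \partial);           *)
(*    parallel edges are distinct list entries;                        *)
(*  - s : the edge sequence, as a list of indices into E.              *)
(* Explorations are considered up to isomorphism ([expl_agree]).       *)
Definition expl := (nat * seq (option nat * option nat) * seq nat)%type.

Definition ex_nv (x : expl) : nat := x.1.1.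
Definition ex_edges (x : expl) : seq (option nat * option nat) := x.1.2.
Definition ex_seq (x : expl) : seq nat := x.2.
Definition ex_edge (x : expl) (i : nat) := nth (None, None) (ex_edges x) i.

Definition expl_wf (x : expl) : Prop :=
  [/\ (0 < ex_nv x)%N,
      (forall i, (i < size (ex_edges x))%N ->
         let e := ex_edge x i in
         [/\ (forall v, e.1 = Some v -> (v < ex_nv x)%N),
             (forall v, e.2 = Some v -> (v < ex_nv x)%N) &
             ~ (e.1 = None /\ e.2 = None)]) &
      (forall j, j \in ex_seq x -> (j < size (ex_edges x))%N)].

Definition map_edge (f : nat -> nat) (e : option nat * option nat) :=
  (omap f e.1, omap f e.2).

Definition expl_iso_via (x y : expl) (f g : nat -> nat) : Prop :=
  [/\ ex_nv x = ex_nv y, size (ex_edges x) = size (ex_edges y),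
      [/\ (forall v, (v < ex_nv x)%N -> (f v < ex_nv y)%N),
          (forall u v, (u < ex_nv x)%N -> (v < ex_nv x)%N -> f u = f v -> u = v)
        & f 0%N = 0%N],
      [/\ (forall i, (i < size (ex_edges x))%N -> (g i < size (ex_edges y))%N),
          (forall i j, (i < size (ex_edges x))%N -> (j < size (ex_edges x))%N ->
                       g i = g j -> i = j)
        & (forall i, (i < size (ex_edges x))%N ->
             let e := map_edge f (ex_edge x i) in
             ex_edge y (g i) = e \/ ex_edge y (g i) = (e.2, e.1))]
    & ex_seq y = map g (ex_seq x)].

Definition expl_agree (x y : expl) : Prop := exists f g, expl_iso_via x y f g.

Section WithReals.
Variable R : realType.

(* finitely supported (sub)probability distributions as weighted lists *)
Definition dist (T : Type) := seq (R * T).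
Definition dret (T : Type) (x : T) : dist T := [:: (1, x)].
Definition dbind (T U : Type) (d : dist T) (f : T -> dist U) : dist U :=
  flatten [seq [seq (p.1 * q.1, q.2) | q <- f p.2] | p <- d].
Definition dmap (T U : Type) (f : T -> U) (d : dist T) : dist U :=
  [seq (p.1, f p.2) | p <- d].
Definition unif (T : Type) (s : seq T) : dist T :=
  [seq ((size s)%:R^-1, x) | x <- s].
Definition mass (T : Type) (d : dist T) (P : T -> bool) : R :=
  \sum_(p <- d) (if P p.2 then p.1 else 0).

(* exploration rules: isomorphism-invariant probability kernels from
   explorations to edges; [K x (Some i)] is the probability of choosing the
   edge with index i, [K x None] that of choosing no edge *)
Definition exploration_rule (K : expl -> option nat -> R) : Prop :=
  (forall x, expl_wf x ->
     [/\ (forall o, 0 <= K x o),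
         (forall i, (size (ex_edges x) <= i)%N -> K x (Some i) = 0) &
         K x None + \sum_(i < size (ex_edges x)) K x (Some (nat_of_ord i)) = 1]) /\
  (forall x y f g, expl_wf x -> expl_wf y -> expl_iso_via x y f g ->
     K y None = K x None /\
     (forall i, (i < size (ex_edges x))%N -> K y (Some (g i)) = K x (Some i))).

(* State: the disclosed vertices in order of disclosure (root first)   *)
(* and the chosen edges (indices in es).                               *)
Section Explore.
Variables (V : eqType) (v0 : V) (es : seq (V * V)).
Variable K : expl -> option nat -> R.

Definition gedge (i : nat) : V * V := nth (v0, v0) es i.

Definition disclosed_edges (dv : seq V) : seq nat :=
  [seq i <- iota 0 (size es) | ((gedge i).1 \in dv) || ((gedge i).2 \in dv)].

Definition vpos (dv : seq V) (v : V) : option nat :=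
  if v \in dv then Some (index v dv) else None.

Definition abs_state (st : seq V * seq nat) : expl :=
  let: (dv, ce) := st in
  let DE := disclosed_edges dv in
  (size dv, [seq (vpos dv (gedge i).1, vpos dv (gedge i).2) | i <- DE],
   [seq index i DE | i <- ce]).

Definition add_vertex (v : V) (dv : seq V) := if v \in dv then dv else rcons dv v.

Definition expl_step (st : seq V * seq nat) : dist (seq V * seq nat) :=
  let: (dv, ce) := st in
  let x := abs_state st in
  let DE := disclosed_edges dv in
  (K x None, st) ::
  [seq (K x (Some j),
        let i := nth 0%N DE j in
        (add_vertex (gedge i).2 (add_vertex (gedge i).1 dv), rcons ce i))
  | j <- iota 0 (size DE)].

Fixpoint explore_states (k : nat) (st : seq V * seq nat) : dist (seq V * seq nat) :=
  match k with
  | 0 => dret st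
  | k'.+1 => dbind (expl_step st) (explore_states k')
  end.

Definition exploration (k : nat) (o : V) : dist expl :=
  dmap abs_state (explore_states k ([:: o], [::])).
End Explore.

Fixpoint pairings_aux (T : Type) (k : nat) (s : seq T) : seq (seq (T * T)) :=
  match s, k with
  | [::], _ => [:: [::]]
  | _ :: _, 0 => [::]
  | h :: t, k'.+1 =>
      flatten [seq [seq (h, nth h t i) :: p
                   | p <- pairings_aux k' (take i t ++ drop i.+1 t)]
              | i <- iota 0 (size t)]
  end.
(* all perfect matchings of the list s (each listed once) *)
Definition pairings (T : Type) (s : seq T) := pairings_aux (size s) s.

Definition half_edges (n : nat) (d : nat -> nat) : seq (nat * nat) :=
  flatten [seq [seq (j, r) | r <- iota 0 (d j)] | j <- iota 0 n].

Definition pairing_edges (p : seq ((nat * nat) * (nat * nat))) : seq (nat * nat) :=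
  [seq (q.1.1, q.2.1) | q <- p].

Definition config_exploration (n : nat) (d : nat -> nat)
    (K : expl -> option nat -> R) (k : nat) : dist expl :=
  dbind (unif (pairings (half_edges n d))) (fun p =>
  dbind (unif (iota 0 n)) (fun o =>
  exploration 0%N (pairing_edges p) K k o)).

(* GWP(D, D^* ) trees, vertices labelled by Ulam-Harris words.         *)
(* [gw_gen offs h u c] is the law of the edges below u (u having c     *)
(* children), down to h further generations, each non-root vertex      *)
(* having an independent [offs]-distributed number of children.       *)
Fixpoint gw_gen (offs : dist nat) (h : nat) (u : seq nat) (c : nat)
    : dist (seq (seq nat * seq nat)) :=
  match h with
  | 0 => dret [::]
  | h'.+1 =>
      foldr (fun i acc =>
        dbind offs (fun c' =>
        dbind (gw_gen offs h' (rcons u i) c') (fun t =>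
        dbind acc (fun rest => dret ((u, rcons u i) :: t ++ rest)))))
      (dret [::]) (iota 0 c)
  end.

Definition deg_sum (n : nat) (d : nat -> nat) : nat := \sum_(k < n) d k.
Definition law_D (n : nat) (d : nat -> nat) : dist nat :=
  [seq (n%:R^-1, d k) | k <- iota 0 n].
Definition law_Dstar_minus1 (n : nat) (d : nat -> nat) : dist nat :=
  [seq ((d k)%:R / (deg_sum n d)%:R, (d k).-1) | k <- iota 0 n].

(* law of the k-step K-exploration of a GWP(D_n, D_n^* )-tree.  The tree is
   generated down to depth k+1 (all vertices of depth <= k get their
   children); a k-step exploration only discloses vertices of depth <= k,
   so this is the law of the k-step exploration of the full tree. *)
Definition gw_exploration (n : nat) (d : nat -> nat)
    (K : expl -> option nat -> R) (k : nat) : dist expl :=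
  dbind (law_D n d) (fun c =>
  dbind (gw_gen (law_Dstar_minus1 n d) k.+1 [::] c) (fun es =>
  exploration [::] es K k [::])).

Definition is_coupling (pi : dist (expl * expl)) (mu nu : dist expl) : Prop :=
  [/\ (forall p, p \in pi -> 0 <= p.1),
      (forall x, mass pi (fun q => q.1 == x) = mass mu (pred1 x)) &
      (forall y, mass pi (fun q => q.2 == y) = mass nu (pred1 y))].

Definition agree_prob (pi : dist (expl * expl)) : R :=
  mass pi (fun q => `[< expl_agree q.1 q.2 >]).

Definition mean_Dstar_min_sqrt (n : nat) (d : nat -> nat) : R :=
  (deg_sum n d)%:R^-1 *
  \sum_(k < n) (d k)%:R * Num.min ((d k)%:R) (Num.sqrt (n%:R : R)).

End WithReals.

(* Main.v *)
Require Import Defs.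
From HB Require Import structures.
From mathcomp Require Import all_boot all_order all_algebra.
From mathcomp Require Import boolp reals.
From mathcomp Require Import ring lra zify.
Set Implicit Arguments. Unset Strict Implicit. Unset Printing Implicit Defensive.
Import Order.TTheory GRing.Theory Num.Theory.
Local Open Scope ring_scope.

(** Both explorations are compared with a reference process that grows a tree whose
    vertices carry labels in {1..n}: the root is uniform, and following an edge attaches
    a uniform half-edge, i.e. a size-biased label.  The process is killed when a label
    repeats or when the sum of the degrees exceeds B = delta * sqrt n.  The branching
    process dominates it, because forgetting the labels only merges states.  The
    configuration model dominates it up to a factor 1 - eta: a given tree with m
    prescribed pairs appears with probability at least N^(-m), and a union bound controls
    further pairs among its at most B free half-edges.  Truncated first moments show that
    the reference process survives with probability close to one.  A coupling of two laws
    that is maximal on isomorphism classes agrees with at least the mass of any measure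
    dominated by both. *)

(** * Finite distributions and maximal couplings *)

Section Dist.
Variable R : realType.

(** A direct coupling would have to follow two adapted explorations whose choices depend on
    isomorphism classes only. Comparing laws avoids this. The labels put both models on one state
    space, where each comparison reduces to the probability of a whole finite labelled tree, [1/n]
    for the root times [1/N] per followed edge. The rule [K] contributes the same factors on all
    sides, because isomorphic states have the same choice probabilities.

    The mean of [D*] may be far too large, hence the truncation at [sqrt n]. Two requirements fix
    the order of [B]. The at most [B^2] pairs among free half-edges must be rare compared with
    [N >= c n], which makes [delta] small. The truncated degree sum after [ell] steps has mean of
    order [ell] times the mean of [min(D*, sqrt n)], which is [o(sqrt n)], hence far below [B] for
    every fixed [delta]. The value of [delta] depends on the tolerated error, but the coupling does
    not: it is chosen once for each [n]. *)

Definition Ex (T : Type) (d : dist R T) (f : T -> R) : R :=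
  \sum_(p <- d) p.1 * f p.2.

Definition nonneg (T : Type) (d : dist R T) := all (fun p => 0 <= p.1) d.

Definition prob (T : Type) (d : dist R T) := nonneg d /\ Ex d (fun=> 1) = 1.

Section Basic.
Variables (T U : Type).
Implicit Types (d : dist R T) (f g : T -> R).

Lemma mass_Ex d P : mass d P = Ex d (fun x => (P x)%:R).
Proof.
by apply: eq_bigr => p _; case: (P p.2); rewrite ?mulr1 ?mulr0.
Qed.

Lemma Ex_ret (x : T) f : Ex (dret R x) f = f x.
Proof. by rewrite /Ex /dret big_seq1 mul1r. Qed.

Lemma Ex_cons p d f : Ex (p :: d) f = p.1 * f p.2 + Ex d f.
Proof. by rewrite /Ex big_cons. Qed.

Lemma Ex_bind d (h : T -> dist R U) (f : U -> R) :
  Ex (dbind d h) f = Ex d (fun x => Ex (h x) f).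
Proof.
rewrite /Ex /dbind big_flatten big_map; apply: eq_bigr => p _.
rewrite big_map big_distrr; apply: eq_bigr => q _ /=; by rewrite mulrA.
Qed.

Lemma Ex_map d (h : T -> U) (f : U -> R) : Ex (dmap h d) f = Ex d (fun x => f (h x)).
Proof. by rewrite /Ex big_map. Qed.

Lemma Ex_unif (s : seq T) f :
  Ex (unif R s) f = (size s)%:R^-1 * \sum_(x <- s) f x.
Proof. by rewrite /Ex big_map big_distrr. Qed.

Lemma eq_Ex d f g : f =1 g -> Ex d f = Ex d g.
Proof. by move=> e; apply: eq_bigr => p _; rewrite e. Qed.

Lemma Ex_ge0 d f : nonneg d -> (forall x, 0 <= f x) -> 0 <= Ex d f.
Proof.
elim: d => [|p d IH]; first by rewrite /Ex big_nil.
rewrite Ex_cons => /andP[p0 /IH h] f0; apply: addr_ge0; last exact: h.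
exact: mulr_ge0.
Qed.

Lemma ExD d f g : Ex d (fun x => f x + g x) = Ex d f + Ex d g.
Proof. by rewrite /Ex -big_split; apply: eq_bigr => p _; rewrite mulrDr. Qed.

Lemma ExB d f g : Ex d (fun x => f x - g x) = Ex d f - Ex d g.
Proof. by rewrite /Ex -sumrB; apply: eq_bigr => p _; rewrite mulrBr. Qed.

Lemma ExZl d c f : Ex d (fun x => c * f x) = c * Ex d f.
Proof. by rewrite /Ex big_distrr; apply: eq_bigr => p _; rewrite mulrCA. Qed.

Lemma ExZr d c f : Ex d (fun x => f x * c) = Ex d f * c.
Proof. by rewrite /Ex big_distrl; apply: eq_bigr => p _; rewrite mulrA. Qed.

Lemma Ex_sum (I : Type) (s : seq I) (P : pred I) d (f : I -> T -> R) :
  Ex d (fun x => \sum_(i <- s | P i) f i x) = \sum_(i <- s | P i) Ex d (f i).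
Proof.
rewrite /Ex exchange_big; apply: eq_bigr => p _; by rewrite big_distrr.
Qed.

Lemma Ex_swap d (d' : dist R U) (f : T -> U -> R) :
  Ex d (fun x => Ex d' (f x)) = Ex d' (fun y => Ex d (f^~ y)).
Proof.
rewrite /Ex; under eq_bigr do rewrite big_distrr.
rewrite exchange_big; apply: eq_bigr => p _ /=; rewrite big_distrr /=.
by apply: eq_bigr => q _; rewrite mulrCA.
Qed.

Lemma prob_ret (x : T) : prob (dret R x).
Proof. by split; rewrite ?Ex_ret // /nonneg /= ler01. Qed.

Lemma prob_map d (h : T -> U) : prob d -> prob (dmap h d).
Proof.
move=> [d0 d1]; split; last by rewrite Ex_map.
by rewrite /nonneg all_map.
Qed.

Lemma prob_unif (s : seq T) : (0 < size s)%N -> prob (unif R s).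
Proof.
move=> s0; split.
  rewrite /nonneg all_map; elim: {2}s => //= x t IH.
  by rewrite IH invr_ge0 ler0n.
rewrite Ex_unif big_const_seq count_predT iter_addr addr0 mulVf //.
by rewrite pnatr_eq0 -lt0n.
Qed.

End Basic.

Lemma le_Ex (T : Type) (d : dist R T) (f g : T -> R) :
  nonneg d -> (forall x, f x <= g x) -> Ex d f <= Ex d g.
Proof.
elim: d => [|p d IH]; first by rewrite /Ex !big_nil.
rewrite !Ex_cons => /andP[p0 /IH h] fg; apply: lerD; last exact: h.
by rewrite ler_wpM2l.
Qed.

Lemma prob_bind (T : eqType) (U : Type) (d : dist R T) (h : T -> dist R U) :
  prob d -> (forall p, p \in d -> prob (h p.2)) -> prob (dbind d h).
Proof.
move=> [/allP d0 d1] hp; split.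
  rewrite /nonneg /dbind.
  elim: d d0 hp {d1} => //= p d IH d0 hp.
  rewrite all_cat IH ?andbT; first last.
  - by move=> q qd; apply: hp; rewrite inE qd orbT.
  - by move=> q qd; apply: d0; rewrite inE qd orbT.
  have [+ _] := hp p (mem_head _ _).
  rewrite all_map; apply: sub_all => q /= q0.
  by apply: mulr_ge0 => //; apply: d0; rewrite mem_head.
rewrite Ex_bind -[RHS]d1 /Ex big_seq [RHS]big_seq; apply: eq_bigr => p pd.
have [_ h1] := hp p pd; congr (_ * _); exact: h1.
Qed.

Lemma Ex_ge_mem (T : eqType) (d : dist R T) (f : T -> R) p :
  nonneg d -> (forall x, 0 <= f x) -> p \in d -> p.1 * f p.2 <= Ex d f.
Proof.
move=> d0 f0; elim: d d0 => // q d IH /andP[q0 d0]; rewrite Ex_cons inE.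
case/orP => [/eqP ->|pd]; first by rewrite lerDl Ex_ge0.
by rewrite (le_trans (IH d0 pd)) // lerDr mulr_ge0.
Qed.

Lemma Ex_eq0_mem (T : eqType) (d : dist R T) (f : T -> R) :
  nonneg d -> (forall x, 0 <= f x) -> Ex d f = 0 ->
  forall p, p \in d -> p.1 * f p.2 = 0.
Proof.
move=> d0 f0 E p pd; apply/eqP; rewrite eq_le -{1}E Ex_ge_mem //=.
by rewrite mulr_ge0 // (allP d0).
Qed.

End Dist.

Section MaxCoupling.
Variables (R : realType) (T : eqType) (e : rel T) (mu nu : dist R T).
Hypotheses (er : reflexive e) (es : symmetric e) (et : transitive e).
Hypotheses (mu_prob : prob mu) (nu_prob : prob nu).

(* [mc] and [nc] are the masses of the class of [x]; the common part of the two laws is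
   coupled inside each class, the rest independently. *)
Let mc x := Ex mu (fun y => (e x y)%:R).
Let nc x := Ex nu (fun y => (e x y)%:R).
Let G x := Num.min (mc x) (nc x) / (mc x * nc x).
Let a x := nc x * G x.
Let b x := mc x * G x.
Let A x := mc x <= nc x.
Let M := Ex mu a.
Let k x y := (e x y)%:R * G x + (1 - a x) * (1 - b y) / (1 - M).

Let mu0 : nonneg mu. Proof. by case: mu_prob. Qed.
Let nu0 : nonneg nu. Proof. by case: nu_prob. Qed.

Let mc_ge0 x : 0 <= mc x. Proof. by apply: Ex_ge0 => // y; rewrite ler0n. Qed.
Let nc_ge0 x : 0 <= nc x. Proof. by apply: Ex_ge0 => // y; rewrite ler0n. Qed.

Let e_eq x y : e x y -> e x =1 e y.
Proof.
move=> xy z; apply/idP/idP; last exact: et.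
by apply: et; rewrite es.
Qed.
Let mcE x y : e x y -> mc x = mc y.
Proof. by move=> /e_eq xy; apply: eq_Ex => z; rewrite xy. Qed.
Let ncE x y : e x y -> nc x = nc y.
Proof. by move=> /e_eq xy; apply: eq_Ex => z; rewrite xy. Qed.
Let GE x y : e x y -> G x = G y.
Proof. by move=> xy; rewrite /G (mcE xy) (ncE xy). Qed.

Let G_ge0 x : 0 <= G x.
Proof. by rewrite /G divr_ge0 ?mulr_ge0 // le_min mc_ge0 nc_ge0. Qed.

(** Where both class masses are positive, [a x] is [min (mc x) (nc x) / mc x], the share of [x] that
    the common part places on equivalent points. On its class the lighter law is absorbed
    entirely. *)
Let GA x : A x -> 0 < mc x -> a x = 1.
Proof.
move=> Ax m0; rewrite /a /G min_l //.
have n0 : 0 < nc x by apply: lt_le_trans Ax.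
by field; rewrite !gt_eqF.
Qed.

Let GnA x : ~~ A x -> 0 < nc x -> b x = 1.
Proof.
rewrite /A -ltNge => Ax n0; rewrite /b /G min_r ?ltW //.
have m0 : 0 < mc x by apply: lt_trans Ax.
by field; rewrite !gt_eqF.
Qed.

Let a_le1 x : a x <= 1.
Proof.
have [n0|n0] := eqVneq (nc x) 0; first by rewrite /a n0 mul0r ler01.
have [m0|m0] := eqVneq (mc x) 0.
  by rewrite /a /G m0 mul0r invr0 !mulr0 ler01.
have np : 0 < nc x by rewrite lt_def n0 nc_ge0.
have mp : 0 < mc x by rewrite lt_def m0 mc_ge0.
have -> : a x = Num.min (mc x) (nc x) / mc x by rewrite /a /G; field; rewrite n0 m0.
by rewrite ler_pdivrMr // mul1r ge_min lexx.
Qed.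

Let b_le1 x : b x <= 1.
Proof.
have [n0|n0] := eqVneq (nc x) 0.
  by rewrite /b /G n0 mulr0 invr0 !mulr0 ler01.
have [m0|m0] := eqVneq (mc x) 0; first by rewrite /b m0 mul0r ler01.
have np : 0 < nc x by rewrite lt_def n0 nc_ge0.
have mp : 0 < mc x by rewrite lt_def m0 mc_ge0.
have -> : b x = Num.min (mc x) (nc x) / nc x by rewrite /b /G; field; rewrite n0 m0.
by rewrite ler_pdivrMr // mul1r ge_min lexx orbT.
Qed.

(** Both sides are the double sum of [P x * G x] over equivalent pairs. For [P = 1] this says that
    the common part has the same total mass [M] seen from either law. *)
Let sum_e (P : T -> R) : (forall x y, e x y -> P x = P y) ->
  Ex mu (fun x => P x * a x) = Ex nu (fun y => P y * b y).
Proof.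
move=> Pe; rewrite /a /b /nc /mc.
transitivity (Ex mu (fun x => Ex nu (fun y => (e x y)%:R * (P x * G x)))).
  by apply: eq_Ex => x; rewrite ExZr mulrCA mulrA mulrAC.
rewrite Ex_swap; apply: eq_Ex => y.
rewrite -mulrCA -ExZr; apply: eq_Ex => x; rewrite es.
by case xy: (e y x); rewrite ?mul0r // (Pe _ _ xy) (GE xy) mulrCA mul1r.
Qed.

Let MbE : Ex nu b = M.
Proof.
have := @sum_e (fun=> 1) (fun _ _ _ => erefl).
rewrite (eq_Ex _ (g := a)) ?(eq_Ex nu (g := b)) // => x; exact: mul1r.
Qed.

Let M_le1 : M <= 1.
Proof. by case: mu_prob => _ <-; apply: le_Ex. Qed.

Let k_ge0 x y : 0 <= k x y.
Proof.
apply: addr_ge0; first by rewrite mulr_ge0 ?ler0n.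
by rewrite divr_ge0 ?mulr_ge0 ?subr_ge0.
Qed.

Let k_nu p : p \in mu -> p.1 * Ex nu (k p.2) = p.1.
Proof.
move=> pmu; rewrite /k ExD ExZr -/(nc p.2) -/(a p.2).
rewrite (eq_Ex nu (g := fun y => ((1 - a p.2) / (1 - M)) * (1 - b y))); last first.
  by move=> y; rewrite mulrAC.
rewrite ExZl ExB MbE; have [_ ->] := nu_prob.
(* For [M = 1] the residual term is a division by zero, hence 0. The mean of [1 - a] then vanishes,
   so each entry of [mu] has weight 0 or [a = 1], and no mass is missing. *)
have [M1|M1] := eqVneq M 1; last first.
  by rewrite divfK ?subr_eq0 1?eq_sym // subrKC mulr1.
have : p.1 * (1 - a p.2) = 0.
  apply: (Ex_eq0_mem (f := fun x => 1 - a x) mu0) pmu => [x|]; first by rewrite subr_ge0.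
  by rewrite ExB -/M M1; have [_ ->] := mu_prob; rewrite subrr.
by rewrite M1 subrr mulr0 addr0 mulrBr mulr1 => /subr0_eq.
Qed.

Let k_mu p : p \in nu -> p.1 * Ex mu (k^~ p.2) = p.1.
Proof.
move=> pnu; rewrite /k ExD.
rewrite (eq_Ex mu (g := fun x => (e p.2 x)%:R * G p.2)); last first.
  by move=> x; rewrite es; case xy: (e p.2 x); rewrite ?mul0r // (GE xy).
rewrite ExZr -/(mc p.2) -/(b p.2).
rewrite (eq_Ex mu (g := fun y => ((1 - b p.2) / (1 - M)) * (1 - a y))); last first.
  by move=> y; ring.
rewrite ExZl ExB -/M; have [_ ->] := mu_prob.
have [M1|M1] := eqVneq M 1; last first.
  by rewrite divfK ?subr_eq0 1?eq_sym // subrKC mulr1.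
have : p.1 * (1 - b p.2) = 0.
  apply: (Ex_eq0_mem (f := fun x => 1 - b x) nu0) pnu => [x|]; first by rewrite subr_ge0.
  by rewrite ExB MbE M1; have [_ ->] := nu_prob; rewrite subrr.
by rewrite M1 subrr mulr0 addr0 mulrBr mulr1 => /subr0_eq.
Qed.

Let pi : dist R (T * T) :=
  [seq (p.1 * q.1 * k p.2 q.2, (p.2, q.2)) | p <- mu, q <- nu].

Let Ex_pi f : Ex pi f = Ex mu (fun x => Ex nu (fun y => k x y * f (x, y))).
Proof.
rewrite /Ex big_flatten big_map; apply: eq_bigr => p _.
rewrite big_map big_distrr; apply: eq_bigr => q _ /=.
by rewrite !mulrA.
Qed.

(** [A] collects the classes on which [mu] is the lighter law, so the lower bound is the sum over
    classes of the smaller mass. Written with one invariant event, it lets lower bounds for [mu] on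
    [A] and for [nu] off [A] add up to the total mass of a common minorant. *)
Lemma max_coupling : exists (A : pred T) (pi : dist R (T * T)),
  [/\ forall x y, e x y -> A x = A y,
      [/\ forall p, p \in pi -> 0 <= p.1,
      forall x, mass pi (fun q => q.1 == x) = mass mu (pred1 x) &
      forall y, mass pi (fun q => q.2 == y) = mass nu (pred1 y)] &
      Ex mu (fun x => (A x)%:R) + Ex nu (fun x => (~~ A x)%:R)
        <= mass pi (fun q => e q.1 q.2)].
Proof.
exists A, pi; split; [|split|].
- by move=> x y xy; rewrite /A (mcE xy) (ncE xy).
- move=> p /allpairsP[[q r] [qm rn ->]] /=.
  by apply: mulr_ge0 => //; apply: mulr_ge0; [exact: (allP mu0)|exact: (allP nu0)].
- move=> x; rewrite !mass_Ex Ex_pi /Ex big_seq [RHS]big_seq.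
  apply: eq_bigr => p pm /=; rewrite -[in RHS](k_nu pm) -mulrA -ExZr //.
- move=> x; rewrite !mass_Ex Ex_pi Ex_swap /Ex big_seq [RHS]big_seq.
  by apply: eq_bigr => p pm /=; rewrite -[in RHS](k_mu pm) -mulrA -ExZr.
- rewrite mass_Ex Ex_pi /=.
  apply: (@le_trans _ _ M); last first.
    apply: le_Ex => // x; rewrite /a /nc -ExZr.
    apply: le_Ex => // y /=; rewrite /k; case: (e x y); rewrite ?mul0r ?mulr0 // mulr1 mul1r.
    by rewrite lerDl divr_ge0 ?mulr_ge0 ?subr_ge0.
  have -> : M = Ex mu (fun x => (A x)%:R * a x) + Ex nu (fun x => (~~ A x)%:R * b x).
    rewrite -sum_e => [|x y xy]; last by rewrite /A (mcE xy) (ncE xy).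
    rewrite -ExD; apply: eq_Ex => x.
    by case: (A x); rewrite ?mul1r ?mul0r ?addr0 ?add0r.
  apply: lerD; rewrite /Ex big_seq [X in _ <= X]big_seq; apply: ler_sum => p pm.
    have := allP mu0 p pm; rewrite le_eqVlt => /orP[/eqP <-|p0]; first by rewrite !mul0r.
    case Ap : (A p.2); rewrite ?mul0r // GA ?mulr1 //.
    have := Ex_ge_mem (f := fun y => (e p.2 y)%:R) mu0 _ pm; rewrite er mulr1.
    by move=> h; apply: lt_le_trans p0 (h _) => y; rewrite ler0n.
  have := allP nu0 p pm; rewrite le_eqVlt => /orP[/eqP <-|p0]; first by rewrite !mul0r.
  case Ap : (A p.2); rewrite ?mul0r //= GnA ?Ap ?mulr1 //.
  have := Ex_ge_mem (f := fun y => (e p.2 y)%:R) nu0 _ pm; rewrite er mulr1.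
  by move=> h; apply: lt_le_trans p0 (h _) => y; rewrite ler0n.
Qed.
End MaxCoupling.

(** * Isomorphism of explorations *)

Section Iso.

Lemma expl_agree_refl x : expl_agree x x.
Proof.
exists id, id; split=> //; last by rewrite map_id.
by split=> // i _ /=; left; rewrite /map_edge; case: (ex_edge x i) => [[a|] [b|]].
Qed.

Lemma expl_agree_trans y x z : expl_agree x y -> expl_agree y z -> expl_agree x z.
Proof.
move=> [f [g [n1 s1 [f1 f2 f3] [g1 g2 g3] c1]]].
move=> [f' [g' [n1' s1' [f1' f2' f3'] [g1' g2' g3'] c1']]].
exists (f' \o f), (g' \o g); split.
- by rewrite n1.
- by rewrite s1.
- split=> /= [v vx|u v ux vx|]; first by apply/f1'/f1.
    by move/f2' => h; apply: f2 => //; apply: h; apply: f1.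
  by rewrite f3.
- split=> /= [v vx|u v ux vx|i ix]; first by apply/g1'/g1.
    by move/g2' => h; apply: g2 => //; apply: h; apply: g1.
  have := g3' _ (g1 _ ix); have := g3 _ ix.
  rewrite /map_edge; case: (ex_edge x i) => a b /=.
  by case=> ->; case=> -> /=; move: a b => [a|] [b|] /=; (by left) || by right.
- by rewrite c1' c1 map_comp.
Qed.

Lemma finite_inverse n (f : nat -> nat) :
  (forall v, v < n -> f v < n)%N ->
  (forall u v, u < n -> v < n -> f u = f v -> u = v)%N ->
  exists f', [/\ (forall v, v < n -> f' v < n)%N,
     (forall v, v < n -> f (f' v) = v)%N & (forall v, v < n -> f' (f v) = v)%N].
Proof.
move=> f1 f2; pose s := [seq f i | i <- iota 0 n].
have us : uniq s.
  rewrite map_inj_in_uniq ?iota_uniq // => u v; rewrite !mem_iota /= !add0n.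
  exact: f2.
have ss : s =i iota 0 n.
  apply: (uniq_min_size us _ _).2; last by rewrite size_map size_iota.
  by move=> x /mapP[i]; rewrite !mem_iota !add0n => /= ? ->; exact: f1.
have szs : size s = n by rewrite size_map size_iota.
have f'1 v : (v < n)%N -> (index v s < n)%N.
  by move=> vn; rewrite -szs index_mem ss mem_iota.
have ff' v : (v < n)%N -> f (index v s) = v.
  move=> vn; have := nth_index 0%N (_ : v \in s).
  rewrite ss mem_iota (nth_map 0%N) ?size_iota ?f'1 // nth_iota ?f'1 //.
  by apply.
exists (fun v => index v s); split=> // v vn.
by apply: f2; rewrite ?ff' ?f'1 ?f1.
Qed.

(** The maps of an isomorphism are controlled on indices in range only. Well-formedness keeps all
    endpoints and all entries of the edge sequence in that range, where the inverses exist. *)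
Lemma expl_agree_sym x y : expl_wf x -> expl_agree x y -> expl_agree y x.
Proof.
move=> [x0 wx cx] [f [g [n1 s1 [f1 f2 f3] [g1 g2 g3] c1]]].
rewrite -n1 in f1; rewrite -s1 in g1.
have [f' [f'1 ff' f'f]] := finite_inverse f1 f2.
have [g' [g'1 gg' g'g]] := finite_inverse g1 g2.
exists f', g'; rewrite /expl_iso_via -n1 -s1; split=> //.
- split=> // [u v ux vx h|]; first by rewrite -(ff' u) // -(ff' v) // h.
  by rewrite -[in LHS]f3 f'f.
- split=> // [u v ux vx h|j jx]; first by rewrite -(gg' u) // -(gg' v) // h.
  have ix := g'1 j jx; have [w1 w2 _] := wx _ ix.
  have mK (a : option nat) : (forall v, a = Some v -> (v < ex_nv x)%N) ->
      omap f' (omap f a) = a by case: a => //= v /(_ v erefl) /f'f ->.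
  have := g3 _ ix; rewrite gg' // => -[] -> /=; rewrite /map_edge /= !mK //.
    by left; case: (ex_edge x (g' j)).
  by right; case: (ex_edge x (g' j)).
- rewrite c1 -map_comp -[LHS]map_id; apply/eq_in_map => i ix /=.
  by rewrite g'g ?cx.
Qed.
End Iso.

(** * Concrete exploration states and their abstract images *)

Section Exploration.
Variables (R : realType) (V : eqType) (v0 : V) (es : seq (V * V)).
Implicit Types (st : seq V * seq nat) (dv : seq V) (z : expl) (gm : seq nat).

Definition state_ok st :=
  (0 < size st.1)%N && all (mem (disclosed_edges v0 es st.1)) st.2.

Definition next_state st i : seq V * seq nat :=
  (add_vertex (gedge v0 es i).2 (add_vertex (gedge v0 es i).1 st.1), rcons st.2 i).

(** The state [st] of a concrete graph realises the abstract exploration [z]. Vertices come in the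
    same order on both sides, so the vertex map is the identity. The edges of [z] come in order of
    discovery, those of [abs_state] by index in [es], and [gm] translates between them; orientation
    may differ. *)
Definition matches st z gm :=
  [/\ (0 < size st.1)%N, size st.1 = ex_nv z, size gm = size (ex_edges z),
      perm_eq gm (disclosed_edges v0 es st.1) &
  [/\ (forall j, (j < size gm)%N ->
        let e := gedge v0 es (nth 0%N gm j) in
        let e' := (vpos st.1 e.1, vpos st.1 e.2) in
        ex_edge z j = e' \/ ex_edge z j = (e'.2, e'.1)),
      (forall j, j \in ex_seq z -> (j < size gm)%N) &
      st.2 = [seq nth 0%N gm j | j <- ex_seq z]]].

Lemma disclosed_edges_uniq dv : uniq (disclosed_edges v0 es dv).
Proof. by rewrite filter_uniq ?iota_uniq. Qed.

Lemma mem_disclosed dv i : (i \in disclosed_edges v0 es dv) =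
  (i < size es)%N &&
  (((gedge v0 es i).1 \in dv) || ((gedge v0 es i).2 \in dv)).
Proof. by rewrite mem_filter mem_iota add0n andbC. Qed.

Lemma abs_stateE st : abs_state v0 es st =
  (size st.1, [seq (vpos st.1 (gedge v0 es i).1, vpos st.1 (gedge v0 es i).2)
              | i <- disclosed_edges v0 es st.1],
   [seq index i (disclosed_edges v0 es st.1) | i <- st.2]).
Proof. by case: st. Qed.

Lemma vpos_lt dv v p : vpos dv v = Some p -> (p < size dv)%N.
Proof. by rewrite /vpos; case: ifP => // vd [<-]; rewrite index_mem. Qed.

Lemma vpos_wf dv i : i \in disclosed_edges v0 es dv ->
  let e := (vpos dv (gedge v0 es i).1, vpos dv (gedge v0 es i).2) in
  [/\ (forall v, e.1 = Some v -> (v < size dv)%N),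
      (forall v, e.2 = Some v -> (v < size dv)%N) & ~ (e.1 = None /\ e.2 = None)].
Proof.
rewrite mem_disclosed => /andP[_ h] /=; split=> [v|v|]; try exact: vpos_lt.
by rewrite /vpos => -[]; case/orP: h => ->.
Qed.

Lemma abs_state_wf st : state_ok st -> expl_wf (abs_state v0 es st).
Proof.
move=> /andP[s0 /allP sc]; rewrite abs_stateE; split=> //=.
- rewrite /ex_edges /ex_edge /= => i; rewrite size_map => ilt.
  rewrite (nth_map 0%N) //; exact/vpos_wf/mem_nth.
- move=> j /mapP[i ii ->]; rewrite /ex_edges /= size_map index_mem; exact: sc.
Qed.

Lemma add_vertex_sub v dv : {subset dv <= add_vertex v dv}.
Proof. by rewrite /add_vertex; case: ifP => _ x //; rewrite mem_rcons inE => ->; rewrite orbT. Qed.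

Lemma next_state_ok st i :
  state_ok st -> i \in disclosed_edges v0 es st.1 -> state_ok (next_state st i).
Proof.
move=> /andP[s0 /allP sc] iD.
have sub : {subset disclosed_edges v0 es st.1 <= disclosed_edges v0 es (next_state st i).1}.
  move=> k; rewrite !mem_disclosed => /andP[-> /=] h; apply/orP.
  by case/orP: h => h; [left|right]; do 2!apply: add_vertex_sub.
apply/andP; split.
  rewrite /= /add_vertex; case: ifP => _; case: ifP => _; by rewrite ?size_rcons.
by apply/allP => k; rewrite mem_rcons inE => /orP[/eqP->|/sc]; apply: sub.
Qed.

Section Kernel.
Variable K : expl -> option nat -> R.
Hypothesis HK : exploration_rule K.

Lemma Ex_step st F : Ex (expl_step v0 es K st) F =
  K (abs_state v0 es st) None * F st +
  \sum_(i <- disclosed_edges v0 es st.1)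
     K (abs_state v0 es st) (Some (index i (disclosed_edges v0 es st.1))) *
     F (next_state st i).
Proof.
case: st => dv ce; rewrite /expl_step Ex_cons; congr (_ + _).
rewrite /Ex big_map [RHS](big_nth 0%N) /index_iota subn0 big_seq [RHS]big_seq.
apply: eq_bigr => i; rewrite mem_iota add0n => /= ilt.
by rewrite index_uniq ?disclosed_edges_uniq.
Qed.

Lemma prob_step st : state_ok st -> prob (expl_step v0 es K st).
Proof.
move=> sok; have [h1 _] := HK.
have [K0 _ K1] := h1 _ (abs_state_wf sok).
split.
  case: st {sok} K0 K1 => dv ce K0 K1; rewrite /nonneg /= K0 all_map.
  by apply/allP => i _ /=.
rewrite Ex_step -[RHS]K1 mulr1; congr (_ + _).
have -> : size (ex_edges (abs_state v0 es st)) = size (disclosed_edges v0 es st.1).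
  by rewrite abs_stateE /ex_edges size_map.
rewrite (big_nth 0%N) big_mkord; apply: eq_bigr => i _.
by rewrite index_uniq ?disclosed_edges_uniq ?mulr1.
Qed.

Lemma prob_explore k st : state_ok st -> prob (explore_states v0 es K k st).
Proof.
elim: k st => [|k IH] st sok; first exact: prob_ret.
apply: prob_bind; first exact: prob_step.
case: st sok => dv ce sok p; rewrite inE => /orP[/eqP ->|]; first exact: IH.
move=> /mapP[j]; rewrite mem_iota add0n => /= jlt -> /=.
by apply: IH; apply: (@next_state_ok (dv, ce)) => //; apply: mem_nth.
Qed.

Lemma matches_iso st z gm : matches st z gm ->
  expl_iso_via z (abs_state v0 es st) id
    (fun j => index (nth 0%N gm j) (disclosed_edges v0 es st.1)).
Proof.
move=> [s0 sv sg pm [ge gc cE]]; rewrite abs_stateE.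
have gD j : (j < size gm)%N -> nth 0%N gm j \in disclosed_edges v0 es st.1.
  by move=> jl; rewrite -(perm_mem pm) mem_nth.
have ug : uniq gm by rewrite (perm_uniq pm) disclosed_edges_uniq.
rewrite /ex_nv /ex_edges /ex_edge /ex_seq /=; split=> //=.
- by rewrite size_map -(perm_size pm).
- by split=> // v; rewrite sv.
- rewrite -sg; split.
  + by move=> i il; rewrite size_map index_mem gD.
  + move=> i j il jl h; apply/eqP; rewrite -(nth_uniq 0%N il jl ug); apply/eqP.
    by rewrite -(nth_index 0%N (gD _ il)) h nth_index ?gD.
  + move=> i il /=; rewrite /ex_edge /ex_edges /= (nth_map 0%N) ?index_mem ?gD // nth_index ?gD //.
    have := ge i il; rewrite /ex_edge /ex_edges /map_edge /= => -[] -> /=; rewrite ?omap_id;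
    case: (vpos _ _) => [?|]; case: (vpos _ _) => [?|]; by [left|right].
- rewrite cE -map_comp; by apply: eq_map.
Qed.

Lemma matches_ok st z gm : matches st z gm -> state_ok st.
Proof.
move=> [s0 sv sg pm [ge gc cE]]; rewrite /state_ok s0 cE /=.
apply/allP => i /mapP[j /gc jl ->] /=; by rewrite -(perm_mem pm) mem_nth.
Qed.

Lemma matches_wf st z gm : matches st z gm -> expl_wf z.
Proof.
move=> [s0 sv sg pm [ge gc cE]]; split; first by rewrite -sv.
  rewrite -sg -sv => i il.
  have [] := @vpos_wf st.1 (nth 0%N gm i); first by rewrite -(perm_mem pm) mem_nth.
  by have := ge i il => /= -[] -> /= h1 h2 h3; split=> // -[? ?]; apply: h3.
by rewrite -sg.
Qed.

Lemma matches_agree st z gm : matches st z gm ->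
  expl_agree z (abs_state v0 es st) /\ expl_agree (abs_state v0 es st) z.
Proof.
move=> m; have a : expl_agree z (abs_state v0 es st).
  by exists id; eexists; apply: matches_iso m.
by split=> //; apply: expl_agree_sym a; apply: matches_wf m.
Qed.

(** Isomorphism invariance of the rule enters here: the choice probabilities depend on [z] alone and
    no longer on the graph that realises it. *)
Lemma matches_step st z gm F : matches st z gm ->
  Ex (expl_step v0 es K st) F = K z None * F st +
    \sum_(j <- iota 0 (size gm)) K z (Some j) * F (next_state st (nth 0%N gm j)).
Proof.
move=> m; rewrite Ex_step.
have [_ /(_ _ _ _ _ (matches_wf m) (abs_state_wf (matches_ok m)) (matches_iso m)) [KN KS]] := HK.
rewrite KN; congr (_ + _); have [s0 sv sg pm [ge gc cE]] := m.
rewrite -(perm_big _ pm) /= (big_nth 0%N) /index_iota subn0.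
rewrite big_seq [RHS]big_seq; apply: eq_bigr => i; rewrite mem_iota add0n => /= il.
by rewrite KS // -sg.
Qed.

End Kernel.
End Exploration.

(** * The reference process *)

Lemma half_edges_mem n d h :
  (h \in half_edges n d) = (h.1 < n)%N && (h.2 < d h.1)%N.
Proof.
apply/flatten_mapP/andP => [[j]|[h1 h2]].
  rewrite mem_iota add0n => /= jn /mapP[r]; rewrite mem_iota add0n => /= rd -> //.
exists h.1; first by rewrite mem_iota add0n.
by apply/mapP; exists h.2; [rewrite mem_iota add0n|case: h {h1 h2}].
Qed.

Lemma half_edges_uniq n d : uniq (half_edges n d).
Proof.
rewrite /half_edges; elim: n => // n IH.
rewrite -addn1 iotaD map_cat flatten_cat cat_uniq IH /= cats0 add0n.
rewrite map_inj_uniq ?iota_uniq ?andbT; last by move=> i j [].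
apply/hasPn => h /mapP[i _ ->]; rewrite (half_edges_mem n d) /=.
by rewrite ltnn.
Qed.

Lemma sum_half_edges (R : nmodType) n d (F : nat -> R) :
  \sum_(h <- half_edges n d) F h.1 = \sum_(k <- iota 0 n) F k *+ d k.
Proof.
rewrite /half_edges big_flatten big_map; apply: eq_bigr => k _.
by rewrite big_map /= big_const_seq count_predT size_iota iter_addr addr0.
Qed.

Lemma size_half_edges n d : size (half_edges n d) = deg_sum n d.
Proof.
rewrite /half_edges size_flatten /shape -map_comp sumnE big_map /deg_sum.
rewrite -(big_mkord xpredT) /index_iota subn0.
by apply: eq_bigr => k _ /=; rewrite size_map size_iota.
Qed.

(* A partially explored labelled tree.  An entry [((q, a), w)] of [ent] is an edge
   leaving the [q]-th disclosed vertex through the half-edge [a], [w] being the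
   Ulam-Harris word of its other endpoint; [(j, (a, b))] in [rvl] records that the
   [j]-th entry was followed and that its half-edge [a] was matched with [b]. *)
Record rst := Rst {
  labs : seq nat;
  wds : seq (seq nat);
  ent : seq (nat * (nat * nat) * seq nat);
  rvl : seq (nat * ((nat * nat) * (nat * nat)));
  chs : seq nat }.

Definition e0 : nat * (nat * nat) * seq nat := (0%N, (0%N, 0%N), [::]).

Definition opened r j := j \in unzip1 (rvl r).

(** The root is vertex 0, so the edge followed at position [i] of [rvl] discloses vertex [i.+1]. *)
Definition child r j :=
  if opened r j then Some (index j (unzip1 (rvl r))).+1 else None.

Definition zst r : expl :=
  (size (labs r),
   [seq (Some (nth e0 (ent r) j).1.1, child r j) | j <- iota 0 (size (ent r))],
   chs r).

(** Models following an opened edge again: both its ends are already disclosed, so only the edge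
    sequence grows. *)
Definition touch r j := Rst (labs r) (wds r) (ent r) (rvl r) (rcons (chs r) j).

Section Reference.
Variables (R : realType) (n : nat) (d : nat -> nat) (B : R).

Definition start k :=
  Rst [:: k] [:: [::]] [seq (0%N, (k, i), [:: i]) | i <- iota 0 (d k)] [::] [::].

(* The half-edges of [b.1] other than [b] are enumerated through [bump b.2]. *)
Definition reveal r j b :=
  let e := nth e0 (ent r) j in
  Rst (rcons (labs r) b.1) (rcons (wds r) e.2)
    (ent r ++ [seq (size (labs r), (b.1, bump b.2 i), rcons e.2 i)
              | i <- iota 0 (d b.1).-1])
    (rcons (rvl r) (j, (e.1.2, b))) (rcons (chs r) j).

Definition degs r : nat := \sum_(k <- labs r) d k.

Definition allowed r (b : nat * nat) :=
  (b.1 \notin labs r) && ((degs r + d b.1)%:R <= B).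

(** Every vertex but the root spends one half-edge on the edge to its parent. This turns the
    size-biased degree [D*] into [D* - 1] children. *)
Definition cnt r q := (d (nth 0%N (labs r) q) - (0 < q))%N.

Definition heads r := [seq e.1.2 | e <- ent r] ++ [seq x.2.2 | x <- rvl r].

(** Two descriptions of one tree are maintained together: by half-edges ([inv_heads],
    [inv_mem_heads]) for the configuration model, and by words ([inv_words], [inv_children]) for the
    branching process. [inv_depth] later guarantees that the truncated branching tree is deep
    enough. *)
Record inv r : Prop := Inv {
  inv_labs : uniq (labs r);
  inv_lt : forall k, k \in labs r -> (k < n)%N;
  inv_degs : (degs r)%:R <= B;
  inv_size : size (labs r) = (size (rvl r)).+1;
  inv_rlabs : behead (labs r) = [seq x.2.2.1 | x <- rvl r];
  inv_wds : wds r = [::] :: [seq (nth e0 (ent r) x.1).2 | x <- rvl r];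
  inv_rvl : forall x, x \in rvl r ->
    (x.1 < size (ent r))%N /\ x.2.1 = (nth e0 (ent r) x.1).1.2;
  inv_opened : uniq (unzip1 (rvl r));
  inv_ent : forall e, e \in ent r ->
    [/\ (e.1.1 < size (labs r))%N, nth 0%N (labs r) e.1.1 = e.1.2.1 &
        exists2 i, (i < cnt r e.1.1)%N & e.2 = rcons (nth [::] (wds r) e.1.1) i];
  inv_heads : uniq (heads r);
  inv_mem_heads : forall h,
    (h \in heads r) = (h.1 \in labs r) && (h.2 < d h.1)%N;
  inv_words : uniq [seq e.2 | e <- ent r];
  inv_children : forall q i, (q < size (labs r))%N -> (i < cnt r q)%N ->
    exists2 e, e \in ent r & e.1.1 = q /\ e.2 = rcons (nth [::] (wds r) q) i;
  inv_chs : forall j, j \in chs r -> (j < size (ent r))%N;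
  inv_depth : forall q, (q < size (labs r))%N -> (size (nth [::] (wds r) q) <= q)%N }.

Lemma inv_size_wds r : inv r -> size (wds r) = size (labs r).
Proof. by move=> I; rewrite (inv_wds I) /= size_map (inv_size I). Qed.

Lemma inv_word_inj r e e' : inv r -> e \in ent r -> e' \in ent r ->
  e.2 = e'.2 -> e = e'.
Proof.
move=> I; move: (inv_words I); elim: (ent r) => //= x s IH /andP[xs us].
rewrite !inE => /orP[/eqP ->|es] /orP[/eqP ->|e's] // h; last exact: IH.
  by case/mapP: xs; exists e'.
by case/mapP: xs; exists e.
Qed.

Lemma inv_nth_inj r j j' : inv r -> (j < size (ent r))%N -> (j' < size (ent r))%N ->
  (nth e0 (ent r) j).2 = (nth e0 (ent r) j').2 -> j = j'.
Proof.
move=> I jl jl' h; apply/eqP.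
have := nth_uniq [::] (s := [seq e.2 | e <- ent r]); rewrite size_map.
move=> /(_ j j' jl jl' (inv_words I)) <-.
by rewrite !(nth_map e0) // h.
Qed.

Lemma ent_word_neq_nil r e : inv r -> e \in ent r -> e.2 != [::].
Proof.
by move=> I /(inv_ent I)[_ _ [i _ ->]]; rewrite -size_eq0 size_rcons.
Qed.

Lemma inv_wds_uniq r : inv r -> uniq (wds r).
Proof.
move=> I; rewrite (inv_wds I) /=; apply/andP; split.
  apply/mapP => -[x /(inv_rvl I)[xl _] /esym/eqP]; apply/negP.
  exact/(ent_word_neq_nil I)/mem_nth.
have -> : [seq (nth e0 (ent r) x.1).2 | x <- rvl r] =
  [seq (nth e0 (ent r) j).2 | j <- unzip1 (rvl r)] by rewrite -map_comp.
rewrite map_inj_in_uniq ?(inv_opened I) // => j j' /mapP[x xr ->] /mapP[y yr ->].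
by apply: (inv_nth_inj I); [have [] := inv_rvl I xr|have [] := inv_rvl I yr].
Qed.

Lemma word_unopened r j : inv r -> (j < size (ent r))%N -> ~~ opened r j ->
  (nth e0 (ent r) j).2 \notin wds r.
Proof.
move=> I jl jo; rewrite (inv_wds I) inE negb_or (ent_word_neq_nil I) ?mem_nth //=.
apply/mapP => -[x xr h]; have [xl _] := inv_rvl I xr.
by case/negP: jo; rewrite (inv_nth_inj I jl xl h) /opened map_f.
Qed.

Lemma inv_start k : (k < n)%N -> (d k)%:R <= B -> inv (start k).
Proof.
move=> kn dB; split=> //=.
- by move=> i; rewrite inE => /eqP ->.
- by rewrite /degs big_seq1.
- move=> e /mapP[i]; rewrite mem_iota add0n => /= il -> /=; split=> //.
  by exists i => //; rewrite /cnt /= subn0.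
- rewrite /heads /= cats0 -map_comp map_inj_uniq ?iota_uniq //= => i j /= [] //.
- move=> [a b]; rewrite /heads /= cats0 -map_comp inE; apply/mapP/andP => /=.
    by move=> [i]; rewrite mem_iota add0n => /= il [-> ->].
  by move=> [/eqP -> bl]; exists b; rewrite // mem_iota.
- by rewrite -map_comp map_inj_uniq ?iota_uniq //= => i j /= [].
- move=> [|//] i _; rewrite /cnt /= subn0 => il.
  exists (0%N, (k, i), [:: i]) => //; apply/mapP; exists i => //.
  by rewrite mem_iota.
- by case.
Qed.

Lemma inv_touch r j : inv r -> (j < size (ent r))%N -> inv (touch r j).
Proof.
case: r => l w e v c [] *; split=> //= i; rewrite mem_rcons inE => /orP[/eqP ->|] //.
by auto.
Qed.

Lemma degs_reveal r j b : degs (reveal r j b) = (degs r + d b.1)%N.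
Proof. by rewrite /degs /= -cats1 big_cat big_seq1. Qed.

Lemma cnt_reveal r j b q : (q < size (labs r))%N -> cnt (reveal r j b) q = cnt r q.
Proof. by move=> ql; rewrite /cnt /= nth_rcons ql. Qed.

Lemma cnt_reveal_last r j b : (0 < size (labs r))%N ->
  cnt (reveal r j b) (size (labs r)) = (d b.1).-1.
Proof. by move=> sl; rewrite /cnt /= nth_rcons ltnn eqxx sl subn1. Qed.

Lemma heads_reveal r j b : perm_eq (heads (reveal r j b))
  (heads r ++ b :: [seq (b.1, bump b.2 i) | i <- iota 0 (d b.1).-1]).
Proof.
rewrite /heads /= map_cat map_rcons -map_comp /= -!catA perm_cat2l.
by rewrite -cats1 perm_catC /= -catA perm_cat2l /=.
Qed.

Lemma mem_bump b i : (b.2 < d b.1)%N ->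
  (i \in b.2 :: [seq bump b.2 i | i <- iota 0 (d b.1).-1]) = (i < d b.1)%N.
Proof.
move=> bd; rewrite inE; have [->|ib] := eqVneq i b.2; first by rewrite bd.
apply/mapP/idP => /= [[k]|il].
  by rewrite mem_iota add0n /bump => /= kl ->; case: leqP; lia.
exists (unbump b.2 i); last by rewrite unbumpK.
by rewrite mem_iota add0n /unbump /=; case: ltnP; move: ib; lia.
Qed.

(** Freshness of the label [b.1] keeps the half-edges distinct, and the entry [j] being unopened
    keeps the words distinct. *)
Lemma inv_reveal r j b : inv r -> (j < size (ent r))%N -> ~~ opened r j ->
  b \in half_edges n d -> allowed r b -> inv (reveal r j b).
Proof.
move=> I jl jo; rewrite half_edges_mem => /andP[bn bd] /andP[bl bB].
have sl : (0 < size (labs r))%N by rewrite (inv_size I).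
have nthl q : (q < size (labs r))%N -> nth 0%N (labs (reveal r j b)) q = nth 0%N (labs r) q.
  by move=> ql; rewrite /= nth_rcons ql.
have nthw q : (q < size (labs r))%N -> nth [::] (wds (reveal r j b)) q = nth [::] (wds r) q.
  by move=> ql; rewrite /= nth_rcons (inv_size_wds I) ql.
have wj : nth [::] (wds (reveal r j b)) (size (labs r)) = (nth e0 (ent r) j).2.
  by rewrite /= nth_rcons (inv_size_wds I) ltnn eqxx.
have nthe i : (i < size (ent r))%N -> nth e0 (ent (reveal r j b)) i = nth e0 (ent r) i.
  by move=> il; rewrite /= nth_cat il.
split.
- by rewrite /= rcons_uniq bl (inv_labs I).
- move=> k; rewrite /= mem_rcons inE => /orP[/eqP -> //|]; exact: (inv_lt I).
- by rewrite degs_reveal.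
- by rewrite /= !size_rcons (inv_size I).
- rewrite /= map_rcons -(inv_rlabs I); by case: (labs r) sl.
- rewrite [LHS]/= {1}(inv_wds I) [rvl _]/= map_rcons /=; congr (_ :: rcons _ _).
    by apply/eq_in_map => x /(inv_rvl I)[xl _]; rewrite nth_cat xl.
  by rewrite nth_cat jl.
- move=> x; rewrite [rvl _]/= mem_rcons inE size_cat => /orP[/eqP ->|/(inv_rvl I)[xl xE]] /=.
    by rewrite nth_cat jl ltn_addr.
  by rewrite nth_cat xl ltn_addr.
- by rewrite /unzip1 /= map_rcons rcons_uniq (inv_opened I) andbT.
- move=> e; rewrite [ent _]/= mem_cat => /orP[/(inv_ent I)[h1 h2 [i il eE]]|].
    rewrite nthl // nthw // cnt_reveal //; split=> //; last by exists i.
    by rewrite /= size_rcons ltnW.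
  move=> /mapP[i]; rewrite mem_iota add0n => /= il ->; split=> /=.
  + by rewrite size_rcons.
  + by rewrite nth_rcons ltnn eqxx.
  + exists i; first by rewrite cnt_reveal_last.
    by have /= -> := wj.
- rewrite (perm_uniq (heads_reveal _ _ _)) cat_uniq -all_predC (inv_heads I) /=.
  have mb : b \notin heads r by rewrite (inv_mem_heads I) (negbTE bl).
  rewrite mb /=; apply/and3P; split.
  + by apply/allP => h /mapP[i _ ->] /=; rewrite (inv_mem_heads I) /= (negbTE bl).
  + by apply/mapP => -[i _]; case: (b) => b1 b2 [] /eqP; rewrite (negbTE (neq_bump _ _)).
  + rewrite map_inj_uniq ?iota_uniq // => i i' [] h; exact: (can_inj (bumpK b.2)).
- move=> [h1 h2]; rewrite (perm_mem (heads_reveal _ _ _)) mem_cat (inv_mem_heads I) /=.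
  rewrite mem_rcons inE andb_orl orbC; congr (_ || _).
  have bE : ((h1, h2) == b) = (h1 == b.1) && (h2 == b.2) by case: (b).
  rewrite [in LHS]inE bE; have [->|hb] /= := eqVneq h1 b.1.
    rewrite -(mem_bump _ bd) inE; congr (_ || _).
    by apply/mapP/mapP => -[i il]; [case=> ->|move=> ->]; exists i.
  by apply/negP => /mapP[i _ [hb' _]]; rewrite hb' eqxx in hb.
- rewrite /= map_cat cat_uniq (inv_words I) -map_comp /= -all_predC.
  rewrite (map_inj_uniq (f := _ \o _)) ?iota_uniq ?andbT; last first.
    by move=> i i' /= /rcons_inj[].
  apply/allP => w /mapP[i _ ->] /=; apply/mapP => -[e er].
  have [h1 h2 [i' _ ->] /rcons_inj[h _]] := inv_ent I er.
  by have := word_unopened I jl jo; rewrite h mem_nth // (inv_size_wds I).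
- move=> q i; rewrite [labs _]/= size_rcons ltnS leq_eqVlt => /orP[/eqP ->|ql].
    rewrite cnt_reveal_last // wj => il; eexists.
      by rewrite mem_cat; apply/orP; right; apply/mapP; exists i; rewrite ?mem_iota.
    by [].
  rewrite cnt_reveal // nthw // => /(inv_children I ql)[e er eE].
  by exists e => //; rewrite mem_cat er.
- move=> k; rewrite /= mem_rcons inE size_cat => /orP[/eqP ->|/(inv_chs I) h];
  exact: ltn_addr.
- move=> q; rewrite [labs _]/= size_rcons ltnS leq_eqVlt => /orP[/eqP ->|ql].
    rewrite wj; have [h1 _ [i _ ->]] := inv_ent I (mem_nth e0 jl).
    by rewrite size_rcons; apply: (leq_trans _ h1); rewrite ltnS; exact: (inv_depth I).
  by rewrite nthw // (inv_depth I).
Qed.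

Lemma zst_wf r : inv r -> expl_wf (zst r).
Proof.
move=> I; rewrite /expl_wf /ex_edge /ex_edges /ex_nv /ex_seq /=; split.
- by rewrite (inv_size I).
- move=> i; rewrite size_map size_iota => il.
  rewrite (nth_map 0%N) ?size_iota // nth_iota // add0n /=; split=> [v [<-]|v|[] //].
    by have [] := inv_ent I (mem_nth e0 il).
  rewrite /child; case: ifP => // io [<-].
  by rewrite (inv_size I) ltnS -(size_map fst) index_mem.
- by move=> j /(inv_chs I); rewrite size_map size_iota.
Qed.

End Reference.

Section ReferenceValue.
Variables (R : realType) (n : nat) (d : nat -> nat) (B : R).
Variable K : expl -> option nat -> R.
Variable f : expl -> R.

Let S := half_edges n d.
Let N : R := (deg_sum n d)%:R.

(* A killed step contributes 0, so these functionals are sub-probabilities. *)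
Fixpoint ref_value k r : R :=
  match k with
  | 0 => f (zst r)
  | k'.+1 => K (zst r) None * ref_value k' r +
      \sum_(j <- iota 0 (size (ent r))) K (zst r) (Some j) *
        (if opened r j then ref_value k' (touch r j)
         else N^-1 * \sum_(b <- S | allowed d B r b) ref_value k' (reveal d r j b))
  end.

Definition ref_total k : R :=
  n%:R^-1 * \sum_(i <- iota 0 n | (d i)%:R <= B) ref_value k (start d i).

End ReferenceValue.

(** * Domination of the reference process by an abstract graph model *)

Section Domination.
Variables (R : realType) (n : nat) (d : nat -> nat) (B : R).
Variable K : expl -> option nat -> R.
Hypothesis HK : exploration_rule K.
Variable f : expl -> R.
Hypothesis f_ge0 : forall x, 0 <= f x.
Hypothesis f_inv : forall x y, expl_agree x y -> expl_agree y x -> f x = f y.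

Let S := half_edges n d.
Let N : R := (deg_sum n d)%:R.

(** An outcome [w] of law [Om] yields the graph [g w] rooted at [root w]. The event [good w r] says
    that [w] is consistent with the labelled tree [r]; then [stt w r] is the corresponding concrete
    state, and [gam w r] locates the entries of [r] among the edges of [g w]. *)
Variables (T : Type) (Om : dist R T) (V : eqType) (v0 : V).
Variables (g : T -> seq (V * V)) (root : T -> V).
Variables (good : T -> rst -> bool) (stt : T -> rst -> seq V * seq nat).
Variables (gam : T -> rst -> seq nat) (lam0 lam : nat -> R) (rho : R) (L : nat).

Notation inv := (inv n d B).
Notation allowed := (allowed d B).
Notation reveal := (reveal d).
Notation start := (start d).

(* In a model that does not see the labels, one consistent outcome is shared by several
   labelled states; [lam] is the share of each of them (constantly 1 if labels are
   visible), so that the shares of the continuations sum to at most 1. *)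
Definition label_weight r := lam0 (head 0%N (labs r)) * \prod_(k <- behead (labs r)) lam k.

Hypothesis Om_ge0 : nonneg Om.
Hypothesis lam_ge0 : forall k, 0 <= lam k.
Hypothesis lam0_ge0 : forall k, 0 <= lam0 k.
Hypothesis root_good : forall w k, (k < n)%N -> good w (start k) ->
  stt w (start k) = ([:: root w], [::]).
Hypothesis root_sum : forall w,
  \sum_(k <- iota 0 n | (d k)%:R <= B) lam0 k * (good w (start k))%:R <= 1.
Hypothesis good_matches : forall w r, inv r -> good w r ->
  matches v0 (g w) (stt w r) (zst r) (gam w r).
Hypothesis good_touch : forall w r j, inv r -> (j < size (ent r))%N -> opened r j ->
  good w (touch r j) = good w r /\
  stt w (touch r j) = ((stt w r).1, rcons (stt w r).2 (nth 0%N (gam w r) j)).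
Hypothesis good_reveal : forall w r j b, inv r -> (j < size (ent r))%N ->
  ~~ opened r j -> b \in S -> allowed r b -> good w (reveal r j b) ->
  good w r /\
  stt w (reveal r j b) = next_state v0 (g w) (stt w r) (nth 0%N (gam w r) j).
Hypothesis good_sum : forall w r j, inv r -> (j < size (ent r))%N ->
  ~~ opened r j ->
  \sum_(b <- S | allowed r b) lam b.1 * (good w (reveal r j b))%:R <= (good w r)%:R.
Hypothesis good_mass : forall r, inv r -> (size (labs r) <= L.+1)%N ->
  rho * n%:R^-1 * N^-1 ^+ (size (labs r)).-1 <=
  label_weight r * Ex Om (fun w => (good w r)%:R).

Let F w k s := Ex (explore_states v0 (g w) K k s) (fun s => f (abs_state v0 (g w) s)).
Let Phi k r := Ex Om (fun w => (good w r)%:R * F w k (stt w r)).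

Let F_ge0 w k s : state_ok v0 (g w) s -> 0 <= F w k s.
Proof. by move=> ok; apply: Ex_ge0 => //; have [] := prob_explore HK k ok. Qed.

Let label_weight_ge0 r : 0 <= label_weight r.
Proof. by apply: mulr_ge0 => //; apply: prodr_ge0. Qed.

Lemma matches_next_opened w r j : inv r -> (j < size (ent r))%N -> opened r j ->
  matches v0 (g w) (stt w r) (zst r) (gam w r) ->
  next_state v0 (g w) (stt w r) (nth 0%N (gam w r) j) =
  ((stt w r).1, rcons (stt w r).2 (nth 0%N (gam w r) j)).
Proof.
move=> I jl jo [s0 sv sg pm [ge gc cE]].
have jg : (j < size (gam w r))%N by rewrite sg /ex_edges /= size_map size_iota.
have := ge j jg; rewrite /ex_edge /ex_edges /= (nth_map 0%N) ?size_iota //.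
rewrite nth_iota // add0n /child jo /next_state /vpos /add_vertex.
by case: ifP => [i1|_]; case: ifP => [i2|_]; rewrite ?i1 ?i2 //; case.
Qed.

Let X w k r j :=
  (good w r)%:R * F w k (next_state v0 (g w) (stt w r) (nth 0%N (gam w r) j)).

Let PhiS k r : inv r -> Phi k.+1 r =
  K (zst r) None * Phi k r +
  \sum_(j <- iota 0 (size (ent r))) K (zst r) (Some j) * Ex Om (fun w => X w k r j).
Proof.
move=> I; rewrite /Phi -ExZl.
under [X in _ = _ + X]eq_bigr do rewrite -ExZl.
rewrite -Ex_sum -ExD; apply: eq_Ex => w.
rewrite /X; case gr : (good w r); last first.
  rewrite mul0r mul0r mulr0 add0r big1 // => j _; by rewrite mul0r mulr0.
have m := good_matches I gr; rewrite mul1r /F /= Ex_bind (matches_step HK _ m) mul1r.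
have -> : size (gam w r) = size (ent r).
  by have [_ _ -> _ _] := m; rewrite /ex_edges /= size_map size_iota.
by congr (_ + _); apply: eq_bigr => j _; rewrite mul1r.
Qed.

(** Averages over the half-edge that is met. An outcome consistent with [r] gives its continuations
    total share at most 1 by [good_sum], and by [good_reveal] all of them have the same concrete
    next state. Killed continuations are dropped, hence an inequality. *)
Let X_ge k r j : inv r -> (j < size (ent r))%N -> ~~ opened r j ->
  \sum_(b <- S | allowed r b) lam b.1 * Phi k (reveal r j b) <= Ex Om (fun w => X w k r j).
Proof.
move=> I jl jo; under eq_bigr do rewrite -ExZl.
rewrite -Ex_sum; apply: le_Ex => // w; rewrite /X.
case gr : (good w r); last first.
  rewrite mul0r big_seq_cond big1 // => b /andP[bS ab].
  case gb : (good w (reveal r j b)); rewrite ?mul0r ?mulr0 //.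
  by have [] := good_reveal I jl jo bS ab gb; rewrite gr.
set G := F _ _ (next_state _ _ _ _).
have G0 : 0 <= G.
  have m := good_matches I gr; apply/F_ge0/next_state_ok; first exact: matches_ok m.
  have [_ _ sg pm _] := m; rewrite -(perm_mem pm) mem_nth // sg.
  by rewrite /ex_edges /= size_map size_iota.
rewrite mul1r; apply: (@le_trans _ _ (\sum_(b <- S | allowed r b)
   lam b.1 * (good w (reveal r j b))%:R * G)).
  rewrite big_seq_cond [X in _ <= X]big_seq_cond; apply: ler_sum => b /andP[bS ab].
  rewrite -mulrA; apply: ler_wpM2l => //.
  case gb : (good w (reveal r j b)); rewrite ?mul0r // !mul1r /G.
  by have [_ ->] := good_reveal I jl jo bS ab gb.
rewrite -big_distrl /= -[X in _ <= X]mul1r ler_wpM2r //.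
by have := good_sum w I jl jo; rewrite gr.
Qed.

Let label_weight_reveal r j b : (0 < size (labs r))%N ->
  label_weight (reveal r j b) = label_weight r * lam b.1.
Proof.
rewrite /label_weight /=; case: (labs r) => //= k l _.
by rewrite -cats1 big_cat big_seq1 mulrA.
Qed.

Let coef r := rho * n%:R^-1 * N^-1 ^+ (size (labs r)).-1.

(** Induction on the number of remaining steps. A reveal multiplies [coef] by [1/N] and
    [label_weight] by [lam b.1], so conditional probabilities of single steps never appear;
    [good_mass] is used for complete trees only, at [k = 0]. A step adds at most one label, which
    keeps the size within [L.+1]. *)
Let ref_value_le k r : inv r -> (size (labs r) + k <= L.+1)%N ->
  coef r * ref_value n d B K f k r <= label_weight r * Phi k r.
Proof.
elim: k r => [|k IH] r I.
  rewrite addn0 => sL /=; rewrite /Phi.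
  rewrite (eq_Ex _ (g := fun w => (good w r)%:R * f (zst r))); last first.
    move=> w; case gr : (good w r); rewrite ?mul0r // !mul1r /F /= Ex_ret.
    by have [a1 a2] := matches_agree (good_matches I gr); apply: f_inv.
  by rewrite ExZr mulrA ler_wpM2r // good_mass.
move=> sL; rewrite PhiS //= !mulrDr.
have wz := zst_wf I; have [h1 _] := HK; have [K0 _ _] := h1 _ wz.
apply: lerD; first by rewrite !(mulrCA _ (K _ _)) ler_wpM2l // IH //; lia.
rewrite !big_distrr /= big_seq [X in _ <= X]big_seq; apply: ler_sum => j.
rewrite mem_iota add0n => /= jl.
rewrite !(mulrCA _ (K _ _)) ler_wpM2l //; case: ifP => jo.
  have It := inv_touch I jl.
  have := IH (touch r j) It; rewrite /= => h; apply: le_trans (h _) _; first by lia.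
  rewrite ler_wpM2l // /Phi; apply: le_Ex => // w.
  rewrite /X; have [-> sE] := good_touch w I jl jo.
  case gr : (good w r); rewrite ?mul0r // sE (matches_next_opened I jl jo) //.
  exact: good_matches.
move/negbT in jo; apply: le_trans (ler_wpM2l (label_weight_ge0 _) (X_ge k I jl jo)).
rewrite !big_distrr /= big_seq_cond [X in _ <= X]big_seq_cond.
apply: ler_sum => b /andP[bS ab].
have Ir := inv_reveal I jl jo bS ab.
have sl : (0 < size (labs r))%N by rewrite (inv_size I).
have := IH _ Ir; rewrite label_weight_reveal // -mulrA => h.
rewrite mulrA; have <- : coef (reveal r j b) = coef r / N.
  rewrite /coef /= size_rcons /=; case: (size (labs r)) sl => // m _ /=.
  by rewrite exprSr mulrA.
by apply: h; rewrite /= size_rcons; lia.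
Qed.

Lemma domination :
  rho * ref_total n d B K f L <=
  Ex Om (fun w => Ex (exploration v0 (g w) K L (root w)) f).
Proof.
have ok0 w : state_ok v0 (g w) ([:: root w], [::]) by [].
apply: (@le_trans _ _ (Ex Om (fun w => (\sum_(k <- iota 0 n | (d k)%:R <= B)
    lam0 k * (good w (start k))%:R) * F w L ([:: root w], [::])))); last first.
  apply: le_Ex => // w; rewrite /exploration Ex_map.
  by rewrite -[X in _ <= X]mul1r ler_wpM2r // F_ge0.
under eq_Ex do rewrite big_distrl /=.
rewrite Ex_sum /ref_total !big_distrr /= big_seq_cond [X in _ <= X]big_seq_cond.
apply: ler_sum => k /andP[]; rewrite mem_iota add0n => /= kn dB.
have := ref_value_le (k := L) (inv_start kn dB) (leqnn _).
rewrite /coef /= expr0 mulr1 mulrA => h; apply: le_trans h _.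
rewrite /label_weight /= big_nil mulr1 /Phi -ExZl; apply: le_Ex => // w.
rewrite mulrA; case gr : (good w (start k)); last by rewrite mulr0 !mul0r.
by rewrite root_good.
Qed.

End Domination.

(** * Counting pairings *)

(** The double factorial [(n-1)!!] for even [n], and 0 for odd [n]. *)
Fixpoint num_pairings (n : nat) : nat :=
  match n with 0 => 1 | 1 => 0 | (m.+1 as n').+1 => (n' * num_pairings m)%N end.

Lemma num_pairingsSS n : num_pairings n.+2 = (n.+1 * num_pairings n)%N.
Proof. by []. Qed.

Section Pairings.
Variable T : eqType.
Implicit Types (S t : seq T) (s p : seq (T * T)).

Definition ends p := unzip1 p ++ unzip2 p.

Definition paired p a b := ((a, b) \in p) || ((b, a) \in p).

Definition has_end a (q : T * T) := (q.1 == a) || (q.2 == a).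

Lemma ends_cons a b p : perm_eq (ends ((a, b) :: p)) [:: a, b & ends p].
Proof.
by apply/permP => P; rewrite /ends /= !count_cat /=; lia.
Qed.

Lemma mem_endsP a p : reflect (exists2 q, q \in p & has_end a q) (a \in ends p).
Proof.
rewrite mem_cat; apply: (iffP orP) => [[/mapP|/mapP] [q qp ->]|[q qp /orP[]/eqP <-]].
- by exists q; rewrite // /has_end eqxx.
- by exists q; rewrite // /has_end eqxx orbT.
- by left; apply: map_f.
- by right; apply: map_f.
Qed.

Lemma paired_ends p a b : paired p a b -> (a \in ends p) /\ (b \in ends p).
Proof.
by case/orP => h; split; apply/mem_endsP; eexists; eauto;
  rewrite /has_end /= eqxx ?orbT.
Qed.

Lemma size_ends p : size (ends p) = (2 * size p)%N.
Proof. by rewrite size_cat !size_map mul2n addnn. Qed.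

Lemma uniq_ends_rem q s : q \in s -> perm_eq (ends s) [:: q.1, q.2 & ends (rem q s)].
Proof.
move=> qs; apply: (@perm_trans _ (ends (q :: rem q s))).
  by rewrite /ends /unzip1 /unzip2; apply: perm_cat; apply: perm_map; exact: perm_to_rem.
by case: q {qs} => a b; exact: ends_cons.
Qed.

Lemma pairings_cons k h t : uniq t -> pairings_aux k.+1 (h :: t) =
  flatten [seq [seq (h, x) :: p | p <- pairings_aux k (rem x t)] | x <- t].
Proof.
move=> ut /=; congr flatten.
have -> : [seq [seq (h, x) :: p | p <- pairings_aux k (rem x t)] | x <- t] =
  [seq [seq (h, nth h t i) :: p | p <- pairings_aux k (rem (nth h t i) t)]
  | i <- iota 0 (size t)].
  by rewrite -[in LHS](mkseq_nth h t) -map_comp mkseq_nth.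
apply/eq_in_map => i; rewrite mem_iota add0n => /= il.
by rewrite remE index_uniq.
Qed.

Lemma mem_pairings k S p : (size S <= k)%N -> uniq S ->
  p \in pairings_aux k S -> perm_eq (ends p) S.
Proof.
elim: k S p => [|k IH] [|h t] p //=; rewrite ?inE; try by move=> _ _ /eqP ->.
rewrite ltnS => sk /andP[ht ut]; rewrite -/(pairings_aux k.+1 (h :: t)) pairings_cons //.
move=> /flatten_mapP[x xt /mapP[p' p'p ->]].
apply: perm_trans (ends_cons _ _ _) _; rewrite perm_cons perm_sym.
apply: perm_trans (perm_to_rem xt) _; rewrite perm_cons perm_sym.
apply: IH p'p; last exact: rem_uniq.
by rewrite size_rem //; case: (t) xt sk => //= ? ? _; lia.
Qed.

Lemma size_rem2 h x t : x \in t -> (size (h :: t) = (size (rem x t)).+2)%N.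
Proof. by move=> xt; rewrite size_rem //; case: (t) xt. Qed.

(** Once the pairs of [s] are fixed, what remains is a perfect matching of the other
    [size S - 2 * size s] elements. The induction follows the enumeration, which always matches the
    first element [h]. *)
Lemma count_pairings k S s : (size S <= k)%N -> uniq S -> uniq (ends s) ->
  {subset ends s <= S} ->
  count (fun p => all (fun q => paired p q.1 q.2) s) (pairings_aux k S) =
  num_pairings (size S - 2 * size s).
Proof.
have nilcase k' s' : uniq (ends s') -> {subset ends s' <= [::]} ->
    count (fun p => all (fun q => paired p q.1 q.2) s') (@pairings_aux T k' [::]) = 1%N.
  by move=> _; case: s' => [|[a b] s'] h; [case: k'|have := h a (mem_head _ _)].
elim: k S s => [|k IH] [|h t] s; try by move=> *; rewrite nilcase.
  by rewrite ltn0.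
rewrite [size _]/= [uniq (_ :: _)]/=.
rewrite ltnS => sk /andP[ht ut] us sS.
rewrite -/(pairings_aux k.+1 (h :: t)) pairings_cons // count_flatten -map_comp sumnE big_map.
under eq_bigr do rewrite /= count_map.
have sst : (2 * size s <= (size t).+1)%N.
  by rewrite -size_ends -[(size t).+1]/(size (h :: t)) uniq_leq_size.
have hrem x p : x \in t -> p \in pairings_aux k (rem x t) ->
    (h \notin ends p) /\ (x \notin ends p).
  move=> xt pp; have sz : (size (rem x t) <= k)%N.
    by have := size_rem2 h xt; rewrite /=; lia.
  have hp := perm_mem (mem_pairings sz (rem_uniq _ ut) pp); rewrite !hp.
  by split; rewrite mem_rem_uniq // !inE ?eqxx ?(negbTE ht) ?andbF.
(* If [h] occurs in a prescribed pair, its partner [y] is forced and a single term of the sum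
   survives. *)
case: (boolP (h \in ends s)) => hs.
  have [y [q [qs hq yt yq]]] : exists y q, [/\ q \in s, q = (h, y) \/ q = (y, h), y \in t
       & uniq [:: q.1, q.2 & ends (rem q s)]].
    have [[q1 q2] qs] := mem_endsP _ _ hs.
    have uq : uniq [:: q1, q2 & ends (rem (q1, q2) s)].
      by rewrite -(perm_uniq (uniq_ends_rem qs)).
    have [m1 m2] : q1 \in h :: t /\ q2 \in h :: t.
      by split; apply: sS; rewrite (perm_mem (uniq_ends_rem qs)) !inE eqxx ?orbT.
    move: (uq); rewrite /= inE negb_or => /andP[/andP[ne _] _].
    rewrite !inE in m1 m2 => /orP[] /= /eqP e; [exists q2|exists q1]; exists (q1, q2); split=> //.
    + by left; rewrite e.
    + by case/orP: m2 => // /eqP e2; rewrite e e2 eqxx in ne.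
    + by right; rewrite e.
    + by case/orP: m1 => // /eqP e2; rewrite e e2 eqxx in ne.
  have sq : {subset ends (rem q s) <= rem y t}.
    move=> z zq; have : z \in h :: t.
      by apply: sS; rewrite (perm_mem (uniq_ends_rem qs)) !inE zq !orbT.
    move: yq; rewrite /= inE negb_or => /andP[/andP[_ z1] /andP[z2 _]].
    rewrite mem_rem_uniq // !inE; case: eqP => [zh|_ /= ->].
      by move: zq; rewrite zh; case: hq z1 z2 => -> /= /negbTE h1 /negbTE h2; rewrite ?h1 ?h2.
    rewrite andbT; apply: contraTneq zq => ->.
    by case: hq z1 z2 => ->.
  rewrite (bigD1_seq y) //= big1_seq ?addn0; last first.
    move=> x /andP[xy xt]; apply/eqP; rewrite -leqn0 leqNgt -has_count; apply/hasPn => p pp /=.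
    apply/allPn; exists q => //; have [hp xp] := hrem x p xt pp.
    apply/negP => /orP[]; rewrite inE => /orP[/eqP|] h1; case: hq h1 => -> /=.
    + by case=> e; rewrite e eqxx in xy.
    + by case=> e e'; move: xy; rewrite -e' e eqxx.
    + by move=> h1; case/negP: hp; apply/mem_endsP; exists (h, y); rewrite // /has_end eqxx.
    + by move=> h1; case/negP: hp; apply/mem_endsP; exists (y, h); rewrite // /has_end eqxx orbT.
    + by case=> e e'; move: xy; rewrite -e' e eqxx.
    + by case=> e; rewrite e eqxx in xy.
    + by move=> h1; case/negP: hp; apply/mem_endsP; exists (y, h); rewrite // /has_end eqxx orbT.
    + by move=> h1; case/negP: hp; apply/mem_endsP; exists (h, y); rewrite // /has_end eqxx.
  transitivity (num_pairings (size (rem y t) - 2 * size (rem q s))); last first.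
    rewrite !size_rem //; congr num_pairings.
    have : (0 < size s)%N by case: (s) qs.
    have : (0 < size t)%N by case: (t) yt.
    by move: (size s) (size t) => [|a] [|b] //= _ _; rewrite mulnS; lia.
  rewrite -IH ?rem_uniq //; first last.
  - by move: yq => /= /and3P[].
  - by have := size_rem2 h yt; rewrite /=; lia.
  apply: eq_in_count => p pp /=; have [hp yp] := hrem y p yt pp.
  rewrite (perm_all _ (perm_to_rem qs)) /=.
  have -> /= : paired ((h, y) :: p) q.1 q.2.
    by rewrite /paired; case: hq => -> /=; rewrite !mem_head ?orbT.
  apply: eq_in_all => -[a b] abs /=.
  have [ha hb] : a \in ends (rem q s) /\ b \in ends (rem q s).
    by split; apply/mem_endsP; exists (a, b); rewrite // /has_end eqxx ?orbT.
  have hne z : z \in ends (rem q s) -> z != h.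
    move=> /sq; rewrite mem_rem_uniq // inE => /andP[_ zt].
    by apply: contraNneq ht => <-.
  by rewrite /paired !inE !xpair_eqE (negbTE (hne _ ha)) (negbTE (hne _ hb)).
(* Otherwise the partner must avoid [ends s]. All admissible partners contribute equally, and their
   number is the factor in the recursion of [num_pairings]. *)
have ->: (\sum_(x <- t) count (preim (cons (h, x))
     (fun p => all (fun q => paired p q.1 q.2) s)) (pairings_aux k (rem x t)) =
   \sum_(x <- t) (x \notin ends s) * num_pairings ((size t).+1 - 2 * size s - 2))%N.
  apply: eq_big_seq => x xt; case: (boolP (x \in ends s)) => xs; rewrite ?mul0n ?mul1n.
    apply/eqP; rewrite -leqn0 leqNgt -has_count; apply/hasPn => p pp /=.
    have [hp xp] := hrem x p xt pp; have [q qs qx] := mem_endsP _ _ xs.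
    apply/allPn; exists q => //; apply/negP.
    have q1s : q.1 \in ends s by apply/mem_endsP; exists q; rewrite // /has_end eqxx.
    have q2s : q.2 \in ends s by apply/mem_endsP; exists q; rewrite // /has_end eqxx orbT.
    have nh z : z \in ends s -> z == h = false.
      by move=> zs; apply: contraNF hs => /eqP <-.
    case: q qx q1s q2s {qs} => q1 q2 /= qx /nh q1s /nh q2s.
    rewrite /paired !inE !xpair_eqE q1s q2s /= => h1.
    case/negP: xp; have [] := paired_ends (a := q1) (b := q2) h1.
    by case/orP: qx => /eqP /= ->.
  transitivity (num_pairings (size (rem x t) - 2 * size s)); last first.
    by have := size_rem2 h xt; rewrite /= => -[->]; congr num_pairings; lia.
  rewrite -IH ?rem_uniq //; first last.
  - move=> z zs; rewrite mem_rem_uniq // inE; apply/andP; split.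
      by apply: contraNneq xs => <-.
    have := sS z zs; rewrite inE => /orP[/eqP zh|//]; by rewrite -zh zs in hs.
  - by have := size_rem2 h xt; rewrite /=; lia.
  apply: eq_in_count => p pp /=; apply: eq_in_all => -[a b] abs /=.
  have [ha hb] : a \in ends s /\ b \in ends s.
    by split; apply/mem_endsP; exists (a, b); rewrite // /has_end eqxx ?orbT.
  have hne z : z \in ends s -> z == h = false.
    by move=> zs; apply: contraNF hs => /eqP <-.
  by rewrite /paired !inE !xpair_eqE !hne //= andbF.
rewrite -big_distrl /=.
have -> : (\sum_(x <- t) (x \notin ends s) = (size t).+1 - 2 * size s - 1)%N.
  have st : {subset ends s <= t}.
    move=> z zs; have := sS z zs; rewrite inE => /orP[/eqP zh|//].
    by rewrite -zh zs in hs.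
  have e1 : (\sum_(x <- t) (x \notin ends s) = count (fun x => x \notin ends s) t)%N.
    by rewrite -sum1_count [RHS]big_mkcond; apply: eq_bigr => x _; case: (_ \notin _).
  have e2 : count (mem (ends s)) t = (2 * size s)%N.
    rewrite -size_ends -size_filter; apply/perm_size/uniq_perm; rewrite ?filter_uniq //.
    by move=> z; rewrite mem_filter /=; case zs: (z \in ends s) => //=; exact: st.
  have e3 : (2 * size s + count (fun x => x \notin ends s) t = size t)%N.
    by rewrite -e2 -(count_predC (mem (ends s)) t).
  by rewrite e1 -e3 subSn ?leq_addr // addKn subn1.
have : (2 * size s <= size t)%N.
  rewrite -size_ends uniq_leq_size // => z zs; have := sS z zs.
  by rewrite inE => /orP[/eqP zh|//]; rewrite -zh zs in hs.
move=> h1; have -> : ((size t).+1 - 2 * size s = (size t - 2 * size s).+1)%N by lia.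
by case: (size t - 2 * size s)%N => [|m] //; rewrite num_pairingsSS !subSS !subn0.
Qed.

Lemma size_pairings k S : (size S <= k)%N -> uniq S ->
  size (pairings_aux k S) = num_pairings (size S).
Proof.
move=> sk uS; have := @count_pairings k S [::] sk uS isT.
by rewrite /= muln0 subn0 count_predT => -> // z.
Qed.

Lemma count_orb (U : Type) (a b : pred U) (s : seq U) :
  (count (fun u => a u || b u) s <= count a s + count b s)%N.
Proof. by rewrite -count_predUI leq_addr. Qed.

Lemma count_has (U : Type) (I : eqType) (L : seq I) (Q : U -> I -> bool) (s : seq U) :
  (count (fun u => has (Q u) L) s <= \sum_(l <- L) count (Q^~ l) s)%N.
Proof.
elim: L => [|l L IH] /=; first by rewrite big_nil count_pred0.
rewrite big_cons; apply: leq_trans (leq_add (leqnn _) IH).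
rewrite -count_predUI; exact: leq_addr.
Qed.

(* Union bound over the pairs inside [Fr]. *)
Lemma count_pairings_avoid k S s (Fr : seq T) : (size S <= k)%N -> uniq S ->
  uniq (ends s ++ Fr) -> {subset ends s ++ Fr <= S} ->
  (num_pairings (size S - 2 * size s) <=
   count (fun p => all (fun q => paired p q.1 q.2) s &&
                   all (fun q => ~~ ((q.1 \in Fr) && (q.2 \in Fr))) p)
         (pairings_aux k S) +
   size Fr ^ 2 * num_pairings (size S - 2 * size s - 2))%N.
Proof.
move=> sk uS uF sF.
have us : uniq (ends s) by move: uF; rewrite cat_uniq => /andP[].
have sS : {subset ends s <= S} by move=> z zs; apply: sF; rewrite mem_cat zs.
rewrite -(count_pairings sk uS us sS).
(* The condition [l.1 != l.2] discards the diagonal of [Fr]: no element is matched with itself, and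
   [count_pairings] needs [l :: s] to have distinct ends. *)
pose Q (p : seq (T * T)) (l : T * T) :=
  (l.1 != l.2) && all (fun q => paired p q.1 q.2) (l :: s).
pose L := [seq (a, b) | a <- Fr, b <- Fr].
apply: (@leq_trans (count (fun p => (all (fun q => paired p q.1 q.2) s &&
      all (fun q => ~~ ((q.1 \in Fr) && (q.2 \in Fr))) p) || has (Q p) L)
   (pairings_aux k S))).
  rewrite [X in (X <= _)%N](eq_in_count (a2 := predI (fun p =>
    all (fun q => paired p q.1 q.2) s) (mem (pairings_aux k S)))); last first.
    by move=> p pp /=; rewrite pp andbT.
  apply: sub_count => p /= /andP[ps pp]; rewrite ps /= -implyNb; apply/implyP.
  move=> /allPn[q qp]; rewrite negbK => /andP[q1 q2]; apply/hasP; exists q.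
    by apply/allpairsP; exists q; split=> //; case: (q).
  rewrite /Q /= ps {1}/paired -surjective_pairing qp !andbT.
  apply/eqP => q12; have := mem_pairings sk uS pp.
  move=> /perm_uniq; rewrite uS (perm_uniq (uniq_ends_rem qp)) /= q12.
  by rewrite inE eqxx.
apply: leq_trans (_ : _ <= _ + count (fun p => has (Q p) L) (pairings_aux k S))%N _.
  exact: count_orb.
rewrite leq_add2l; apply: leq_trans (count_has _ _ _) _.
apply: (@leq_trans (\sum_(l <- L) num_pairings (size S - 2 * size s - 2))); last first.
  by rewrite big_const_seq count_predT iter_addn_0 size_allpairs mulnn mulnC.
rewrite big_seq [X in (_ <= X)%N]big_seq; apply: leq_sum => l /allpairsP[[a b] [aF bF ->]] /=.
rewrite /Q /=; case ab : (a == b) => /=; first by rewrite count_pred0.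
have pE : perm_eq (ends ((a, b) :: s)) [:: a, b & ends s] by exact: ends_cons.
have -> : (size S - 2 * size s - 2 = size S - 2 * size ((a, b) :: s))%N by rewrite /=; lia.
rewrite -(@count_pairings k S ((a, b) :: s)) //.
- rewrite (perm_uniq pE) /= us andbT inE ab /=.
  have nF z : z \in Fr -> z \notin ends s.
    by move: uF; rewrite cat_uniq => /and3P[_ /hasPn h _] /h.
  by rewrite !nF.
- move=> z; rewrite (perm_mem pE) !inE => /or3P[/eqP ->|/eqP ->|h];
  by apply: sF; rewrite mem_cat ?aF ?bF ?h ?orbT.
Qed.

End Pairings.

(** * The configuration model *)

Section ConfigModel.
Variables (R : realType) (n : nat) (d : nat -> nat) (B : R).

Notation inv := (inv n d B).
Notation he := (nat * nat)%type.

Definition q0 : he * he := ((0%N, 0%N), (0%N, 0%N)).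

Definition swap (q : he * he) := (q.2, q.1).

(* Consistency with [r]: the followed half-edges are paired as recorded, and no other
   pair joins two disclosed vertices. *)
Definition cfg_good (w : seq (he * he) * nat) r :=
  [&& perm_eq (ends w.1) (half_edges n d), w.2 == head 0%N (labs r),
      all (fun x => paired w.1 x.2.1 x.2.2) (rvl r) &
      all (fun q => (q.1.1 \in labs r) && (q.2.1 \in labs r) ==>
                    has (fun x => (q == x.2) || (q == swap x.2)) (rvl r)) w.1].

Definition cfg_gam (w : seq (he * he) * nat) r : seq nat :=
  [seq find (has_end e.1.2) w.1 | e <- ent r].

Definition cfg_st (w : seq (he * he) * nat) r : seq nat * seq nat :=
  (labs r, [seq nth 0%N (cfg_gam w r) j | j <- chs r]).

(** The pair at index [k] owns the positions [k] and [size p + k] of [ends p], so distinctness of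
    [ends p] leaves each half-edge in one pair only. *)
Lemma has_end_inj (T : eqType) (p : seq (T * T)) x0 a i i' : uniq (ends p) ->
  (i < size p)%N -> (i' < size p)%N ->
  has_end a (nth x0 p i) -> has_end a (nth x0 p i') -> i = i'.
Proof.
move=> up il il' h h'.
have pos k : (k < size p)%N -> has_end a (nth x0 p k) ->
    exists2 l, (l == k) || (l == size p + k)%N &
      (l < size (ends p))%N /\ nth a (ends p) l = a.
  move=> kl /orP[/eqP e|/eqP e].
    exists k; first by rewrite eqxx.
    by rewrite size_ends nth_cat size_map kl (nth_map x0) //; split=> //; lia.
  exists (size p + k)%N; first by rewrite eqxx orbT.
  split; first by rewrite size_ends; lia.
  by rewrite nth_cat size_map ltnNge leq_addr /= addKn (nth_map x0).
have [l lE [l1 l2]] := pos _ il h; have [l' lE' [l1' l2']] := pos _ il' h'.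
have /eqP ll : l == l' by rewrite -(nth_uniq a l1 l1' up) l2 l2'.
by move: lE lE'; rewrite -ll => /orP[] /eqP -> /orP[] /eqP; lia.
Qed.

Lemma gedge_pairing p i : gedge 0%N (pairing_edges p) i =
  ((nth q0 p i).1.1, (nth q0 p i).2.1).
Proof.
rewrite /gedge /pairing_edges; have [il|il] := ltnP i (size p).
  by rewrite (nth_map q0).
by rewrite !nth_default // size_map.
Qed.

Lemma nth_index_rvl r x : inv r -> x \in rvl r ->
  nth 0%N (labs r) (index x.1 (unzip1 (rvl r))).+1 = x.2.2.1.
Proof.
move=> I xr; rewrite -nth_behead (inv_rlabs I).
have tl : (index x.1 (unzip1 (rvl r)) < size (rvl r))%N.
  by rewrite -(size_map fst) index_mem map_f.
rewrite (nth_map x) //; congr (_.2.2.1); apply: esym.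
have xi := nth_index x xr; rewrite -{1}xi; congr nth.
have il : (index x (rvl r) < size (rvl r))%N by rewrite index_mem.
have -> : x.1 = nth 0%N (unzip1 (rvl r)) (index x (rvl r)).
  by rewrite (nth_map x) // xi.
by rewrite index_uniq ?size_map // (inv_opened I).
Qed.

Lemma ent_head_mem r e : inv r -> e \in ent r -> e.1.2 \in heads r.
Proof. by move=> I er; rewrite mem_cat (map_f (fun e => e.1.2) er). Qed.

Lemma rvl_head_mem r x : inv r -> x \in rvl r -> x.2.2 \in heads r.
Proof. by move=> I xr; rewrite mem_cat orbC (map_f (fun x => x.2.2)). Qed.

Lemma heads_disjoint r e x : inv r -> e \in ent r -> x \in rvl r -> e.1.2 != x.2.2.
Proof.
move=> I er xr; have := inv_heads I; rewrite cat_uniq => /and3P[_ /hasPn h _].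
apply/eqP => h1; have := h x.2.2 (map_f _ xr); rewrite -h1 /=.
by rewrite (map_f (fun e => e.1.2) er).
Qed.

Lemma ent_head_inj r e e' : inv r -> e \in ent r -> e' \in ent r ->
  e.1.2 = e'.1.2 -> e = e'.
Proof.
move=> I; have := inv_heads I; rewrite cat_uniq => /andP[+ _].
elim: (ent r) => //= x s IH /andP[xs us].
rewrite !inE => /orP[/eqP ->|es] /orP[/eqP ->|e's] // h; last exact: IH.
  by case/mapP: xs; exists e'.
by case/mapP: xs; exists e.
Qed.

Lemma heads_half_edges r : inv r -> {subset heads r <= half_edges n d}.
Proof.
move=> I h; rewrite (inv_mem_heads I) half_edges_mem => /andP[/(inv_lt I) -> //].
Qed.

Lemma rvl_nth r x : inv r -> x \in rvl r -> nth e0 (ent r) x.1 \in ent r.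
Proof. by move=> I /(inv_rvl I)[xl _]; apply: mem_nth. Qed.

Lemma opened_rvl r j : opened r j -> exists2 x, x \in rvl r & x.1 = j.
Proof. by move=> /mapP[x xr ->]; exists x. Qed.

Section Good.
Variables (w : seq (he * he) * nat) (r : rst).
Hypotheses (I : inv r) (gr : cfg_good w r).
Let p := w.1.
Let gperm : perm_eq (ends p) (half_edges n d). Proof. by case/and4P: gr. Qed.
Let guniq : uniq (ends p).
Proof. by rewrite (perm_uniq gperm) half_edges_uniq. Qed.

Lemma cfg_find e : e \in ent r ->
  (find (has_end e.1.2) p < size p)%N /\
  has_end e.1.2 (nth q0 p (find (has_end e.1.2) p)).
Proof.
move=> er; have hp : has (has_end e.1.2) p.
  have : e.1.2 \in ends p.
    by rewrite (perm_mem gperm); apply: (heads_half_edges I); apply: ent_head_mem.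
  by move/mem_endsP => [q qp hq]; apply/hasP; exists q.
by rewrite -has_find nth_find.
Qed.

Lemma cfg_find_eq e i : e \in ent r -> (i < size p)%N ->
  has_end e.1.2 (nth q0 p i) -> find (has_end e.1.2) p = i.
Proof. by move=> er il hi; have [? ?] := cfg_find er; apply: has_end_inj hi. Qed.

Lemma cfg_find_mem e q : e \in ent r -> q \in p -> has_end e.1.2 q ->
  nth q0 p (find (has_end e.1.2) p) = q.
Proof.
move=> er qp hq; rewrite (cfg_find_eq (i := index q p) er) ?index_mem //;
  by rewrite nth_index.
Qed.

(** By consistency a pair between disclosed vertices is a recorded one. Half-edges of entries are
    never partner half-edges ([heads_disjoint]), so [e] must be the entry through which that pair
    was followed. *)
Lemma cfg_inner e i : e \in ent r -> (i < size p)%N ->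
  has_end e.1.2 (nth q0 p i) ->
  (nth q0 p i).1.1 \in labs r -> (nth q0 p i).2.1 \in labs r ->
  exists2 x, x \in rvl r & nth e0 (ent r) x.1 = e.
Proof.
move=> er il hi l1 l2; have [_ _ _ /allP h] := and4P gr.
have := h _ (mem_nth q0 il); rewrite l1 l2 /= => /hasP[x xr xE].
exists x => //; apply: (ent_head_inj I) => //; first exact: rvl_nth.
have [_ <-] := inv_rvl I xr; have := heads_disjoint I er xr.
by case/orP: xE hi => /eqP ->; rewrite /has_end /= => /orP[] /eqP -> //;
  rewrite eqxx.
Qed.

Lemma cfg_rvl x : x \in rvl r ->
  let i := find (has_end (nth e0 (ent r) x.1).1.2) p in
  nth q0 p i = x.2 \/ nth q0 p i = swap x.2.
Proof.
move=> xr /=; have er := rvl_nth I xr; have [_ aE] := inv_rvl I xr.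
have [_ _ /allP h _] := and4P gr.
have : (x.2 \in p) || (swap x.2 \in p).
  by have := h x xr; rewrite /paired -surjective_pairing.
by case/orP => hq; [left|right]; apply: (cfg_find_mem er hq);
  rewrite /has_end -aE /= eqxx ?orbT.
Qed.

Lemma cfg_matches :
  matches 0%N (pairing_edges p) (cfg_st w r) (zst r) (cfg_gam w r).
Proof.
have sg : size (cfg_gam w r) = size (ent r) by rewrite size_map.
have head_lab e : e \in ent r -> e.1.2.1 \in labs r.
  by move=> /(inv_ent I)[h1 <- _]; apply: mem_nth.
split=> //=.
- by rewrite (inv_size I).
- by rewrite sg /ex_edges /= size_map size_iota.
- apply: uniq_perm; rewrite ?disclosed_edges_uniq //.
    rewrite map_inj_in_uniq => [|e e' er e'r he].
      by have := inv_words I; apply: map_uniq.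
    have [il hi] := cfg_find er; have [_ hi'] := cfg_find e'r; rewrite -he in hi'.
    (* Were two different entries the two ends of one pair, this pair would join disclosed vertices
       and be recorded. One of the two half-edges would then be a partner half-edge, against
       [heads_disjoint]. *)
    have [/eqP h|ne] := boolP (e.1.2 == e'.1.2); first exact: (ent_head_inj I).
    have [l1 l2] : (nth q0 p (find (has_end e.1.2) p)).1.1 \in labs r /\
             (nth q0 p (find (has_end e.1.2) p)).2.1 \in labs r.
      move: hi hi'; rewrite /has_end => /orP[] /eqP h1 /orP[] /eqP h2.
      - by move: ne; rewrite -h1 -h2 eqxx.
      - by rewrite h1 h2 !head_lab.
      - by rewrite h1 h2 !head_lab.
      - by move: ne; rewrite -h1 -h2 eqxx.
    have [x xr xE] := cfg_inner er il hi l1 l2.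
    have [x' xr' xE'] := cfg_inner e'r il hi' l1 l2.
    have := cfg_rvl xr; rewrite /= xE => h.
    have [_ aE] := inv_rvl I xr; rewrite xE in aE.
    have nx : x.2.2 = e'.1.2 -> False.
      by move=> h1; move: (heads_disjoint I e'r xr); rewrite h1 eqxx.
    have na : x.2.1 = e'.1.2 -> False by move=> h1; move: ne; rewrite -aE h1 eqxx.
    by move: hi'; rewrite /has_end; case: h => -> /= /orP[] /eqP; do ?[move/nx|move/na].
  move=> i; rewrite mem_disclosed size_map gedge_pairing.
  apply/mapP/andP => [[e er ->]|[il hi]].
    have [il] := cfg_find er; split=> //.
    by move: b; rewrite /has_end => /orP[] /eqP ->; rewrite head_lab ?orbT.
  have hS q : q \in p -> q.1 \in half_edges n d /\ q.2 \in half_edges n d.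
    move=> qp; rewrite -!(perm_mem gperm); split; apply/mem_endsP; exists q => //.
      by rewrite /has_end eqxx.
    by rewrite /has_end eqxx orbT.
  have [h [hh hl hS']] : exists h, [/\ has_end h (nth q0 p i), h.1 \in labs r & h \in half_edges n d].
    have [] := hS _ (mem_nth q0 il) => h1 h2.
    case/orP: hi => hi; [exists (nth q0 p i).1|exists (nth q0 p i).2]; split=> //;
      by rewrite /has_end eqxx ?orbT.
  have : h \in heads r.
    by rewrite (inv_mem_heads I) hl /=; move: hS'; rewrite half_edges_mem => /andP[].
  rewrite mem_cat => /orP[/mapP[e er eh]|/mapP[x xr xh]].
    by exists e => //; rewrite (cfg_find_eq er il) // -eh.
  exists (nth e0 (ent r) x.1); first exact: rvl_nth.
  have [jl _] := cfg_find (rvl_nth I xr).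
  apply: esym; apply: has_end_inj guniq jl il _ hh.
  by case: (cfg_rvl xr) => ->; rewrite /has_end xh eqxx ?orbT.
split=> //; last by move=> j /(inv_chs I); rewrite sg.
move=> j; rewrite sg => jl.
rewrite /ex_edge /ex_edges /= (nth_map 0%N) ?size_iota // nth_iota // add0n.
rewrite (nth_map e0) // gedge_pairing; set e := nth e0 _ _.
have er : e \in ent r by apply: mem_nth.
have [h1 h2 _] := inv_ent I er.
have va : vpos (labs r) e.1.2.1 = Some e.1.1.
  by rewrite /vpos head_lab // -h2 index_uniq // (inv_labs I).
have [il hi] := cfg_find er.
rewrite /child; case: ifP => jo.
  have [x xr xj] := opened_rvl jo.
  have [_ aE] := inv_rvl I xr; rewrite xj -/e in aE.
  have vb : vpos (labs r) x.2.2.1 = Some (index j (unzip1 (rvl r))).+1.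
    have tl : (index j (unzip1 (rvl r))).+1 = index x.2.2.1 (labs r).
      rewrite -(nth_index_rvl I xr) xj index_uniq // ?(inv_labs I) //.
      by rewrite (inv_size I) ltnS -(size_map fst) index_mem.
    rewrite /vpos -tl; case: ifP => //.
    by have := rvl_head_mem I xr; rewrite (inv_mem_heads I) => /andP[->].
  have := cfg_rvl xr; rewrite /= xj -/e => -[] -> /=; rewrite aE va vb; by [left|right].
(* An unopened entry leads to an undisclosed vertex, since otherwise [cfg_inner] would make it a
   recorded one. Its far end is therefore the cemetery in both descriptions. *)
have out y : y.1 \in labs r -> (nth q0 p (find (has_end e.1.2) p) == (e.1.2, y)) ||
     (nth q0 p (find (has_end e.1.2) p) == (y, e.1.2)) -> False.
  move=> yl qE; have [x xr xE] : exists2 x, x \in rvl r & nth e0 (ent r) x.1 = e.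
    by apply: (cfg_inner er il hi); case/orP: qE => /eqP ->; rewrite ?head_lab.
  have [xl _] := inv_rvl I xr.
  have := inv_nth_inj I xl jl; rewrite xE => /(_ erefl) xj.
  by move/negP: jo; apply; rewrite -xj /opened map_f.
have vb y : (nth q0 p (find (has_end e.1.2) p) == (e.1.2, y)) ||
     (nth q0 p (find (has_end e.1.2) p) == (y, e.1.2)) -> vpos (labs r) y.1 = None.
  by move=> qE; rewrite /vpos; case: ifP => // yl; case: (out y yl qE).
case qE : (nth q0 p _) hi vb => [a b] /orP[] /= /eqP -> vb; [left|right].
  by rewrite va (vb b) // eqxx.
by rewrite va (vb a) // eqxx orbT.
Qed.

End Good.

(** The newly recorded pair ends at the fresh label [b.1], so it is irrelevant for pairs among the
    old labels. Consistency thus passes back from the extended tree. *)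
Lemma cfg_reveal w r j b : inv r -> (j < size (ent r))%N ->
  ~~ opened r j -> b \in half_edges n d -> allowed d B r b ->
  cfg_good w (reveal d r j b) ->
  cfg_good w r /\ cfg_st w (reveal d r j b) =
    next_state 0%N (pairing_edges w.1) (cfg_st w r) (nth 0%N (cfg_gam w r) j).
Proof.
move=> I jl jo bS ab gr'; have [bl _] := andP ab.
have [gp gh] := and4P gr'; rewrite /= all_rcons => /andP[/= pj gall] gq.
have gr : cfg_good w r.
  apply/and4P; split=> //; first by move: gh => /=; case: (labs r) (inv_size I).
  apply/allP => q qp; apply/implyP => /andP[l1 l2].
  have := allP gq q qp; rewrite !mem_rcons !inE l1 l2 !orbT /= has_rcons /=.
  case/orP => // /orP[] /eqP qE; move: l1 l2; rewrite qE /= => l1 l2.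
    by rewrite l2 in bl.
  by rewrite l1 in bl.
split=> //.
have er : nth e0 (ent r) j \in ent r by apply: mem_nth.
have [h1 h2 _] := inv_ent I er.
have al : (nth e0 (ent r) j).1.2.1 \in labs r by rewrite -h2 mem_nth.
have gj : nth 0%N (cfg_gam w r) j = find (has_end (nth e0 (ent r) j).1.2) w.1.
  by rewrite (nth_map e0).
rewrite /next_state gj gedge_pairing /cfg_st /=; congr (_, _).
  have add_in (v : nat) (s : seq nat) : v \in s -> add_vertex v s = s by rewrite /add_vertex => ->.
  have add_out (v : nat) (s : seq nat) : v \notin s -> add_vertex v s = rcons s v.
    by rewrite /add_vertex => /negbTE ->.
  case/orP: pj => qp.
    rewrite (cfg_find_mem I gr er qp) /=; last by rewrite /has_end eqxx.
    by rewrite (add_in _ (labs r)) // add_out.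
  rewrite (cfg_find_mem I gr er qp) /=; last by rewrite /has_end eqxx orbT.
  by rewrite (add_out _ (labs r)) // add_in // mem_rcons inE al orbT.
rewrite map_rcons /cfg_gam /= map_cat nth_cat size_map jl gj.
congr rcons; apply/eq_in_map => k /(inv_chs I) kl.
by rewrite nth_cat size_map kl.
Qed.

Lemma sum_unique_le1 (I : eqType) (s : seq I) (A P : pred I) : uniq s ->
  (forall i j, i \in s -> j \in s -> A i -> A j -> P i -> P j -> i = j) ->
  \sum_(i <- s | A i) (P i)%:R <= 1 :> R.
Proof.
elim: s => [|x s IH]; first by rewrite big_nil ler01.
move=> /andP[xs us] h; rewrite big_cons.
have IHs : \sum_(i <- s | A i) (P i)%:R <= 1 :> R.
  by apply: IH => // i j is_ js; apply: h; rewrite inE ?is_ ?js orbT.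
case Ax : (A x) => //; case Px : (P x); last by rewrite add0r.
rewrite big_seq_cond big1 ?addr0 // => i /andP[is_ Ai].
case Pi : (P i) => //; have := h x i (mem_head _ _).
rewrite inE is_ orbT => /(_ isT Ax Ai Px Pi) xi.
by rewrite xi is_ in xs.
Qed.

(** In a fixed pairing the followed half-edge has a single partner. Labels are visible here, so the
    constant share 1 is correct. *)
Lemma cfg_sum w r j : inv r -> (j < size (ent r))%N -> ~~ opened r j ->
  \sum_(b <- half_edges n d | allowed d B r b)
     1 * (cfg_good w (reveal d r j b))%:R <= (cfg_good w r)%:R :> R.
Proof.
move=> I jl jo; under eq_bigr do rewrite mul1r.
case gr : (cfg_good w r); last first.
  rewrite big_seq_cond big1 // => b /andP[bS ab].
  case gb : (cfg_good _ _) => //; have [] := cfg_reveal I jl jo bS ab gb.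
  by rewrite gr.
apply: sum_unique_le1; first exact: half_edges_uniq.
move=> b b' _ _ _ _ /and4P[pw _ h _] /and4P[_ _ h' _].
move: h h'; rewrite /= !all_rcons => /andP[/= p1 _] /andP[/= p2 _].
have uw : uniq (ends w.1) by rewrite (perm_uniq pw) half_edges_uniq.
set a := (nth e0 (ent r) j).1.2 in p1 p2.
have fnd c : paired w.1 a c -> exists2 i, (i < size w.1)%N &
    nth q0 w.1 i = (a, c) \/ nth q0 w.1 i = (c, a).
  case/orP => h; [exists (index (a, c) w.1)|exists (index (c, a) w.1)];
    rewrite ?index_mem ?nth_index //; by [left|right].
have [i il iE] := fnd _ p1; have [i' il' iE'] := fnd _ p2.
have ii : i = i'.
  apply: (has_end_inj (x0 := q0) uw il il') (_ : has_end a _) (_ : has_end a _).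
    by case: iE => ->; rewrite /has_end eqxx ?orbT.
  by case: iE' => ->; rewrite /has_end eqxx ?orbT.
rewrite -ii in iE'.
by case: iE iE' => -> [] [] => [->|-> <-|<- ->|->].
Qed.

End ConfigModel.

(** * Probability of a labelled tree in the configuration model *)

Lemma num_pairings_gt0 n : ~~ odd n -> (0 < num_pairings n)%N.
Proof.
move=> en; have -> : n = n./2.*2 by rewrite -[LHS]odd_double_half (negbTE en).
by elim: n./2 => // m IH; rewrite doubleS num_pairingsSS muln_gt0.
Qed.

(** Each of the [m] factors split off from the double factorial is at most [n]. Hence [m] prescribed
    pairs have probability at least [n^(-m)], with no error term. *)
Lemma num_pairings_le m n : (2 * m <= n)%N ->
  (num_pairings n <= n ^ m * num_pairings (n - 2 * m))%N.
Proof.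
elim: m n => [|m IH] n mn; first by rewrite expn0 mul1n muln0 subn0.
have [n' nE] : exists n', n = n'.+2 by exists n.-2; lia.
rewrite nE num_pairingsSS expnS -mulnA; apply: leq_mul => //.
have -> : (n'.+2 - 2 * m.+1 = n' - 2 * m)%N by lia.
apply: leq_trans (IH n' _) _; first by lia.
rewrite leq_mul2r; apply/orP; right.
by case: (m) => // k; rewrite leq_exp2r //; lia.
Qed.

Section ConfigMass.
Variables (R : realType) (n : nat) (d : nat -> nat) (B : R) (eta : R).
Notation inv := (inv n d B).
Notation he := (nat * nat)%type.
Let N := deg_sum n d.
Let Ps := pairings (half_edges n d).

Definition cfg_law : dist R (seq (he * he) * nat) :=
  dbind (unif R Ps) (fun p => dmap (pair p) (unif R (iota 0 n))).

Hypotheses (N_even : ~~ odd N) (B_ge0 : 0 <= B).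
Hypotheses (eta_ge0 : 0 <= eta) (eta_le1 : eta <= 1).
(** After [m] followed pairs, one more prescribed pair has conditional probability
    [1 / (N - 2m - 1)], where [2m <= B]. There are at most [B^2] pairs to avoid, so the union bound
    costs at most [eta]. *)
Hypothesis B_small : B ^+ 2 <= eta * (N%:R - B - 1).
Hypothesis B_lt : B + 1 <= N%:R.

Let sizeH : size (half_edges n d) = N. Proof. exact: size_half_edges. Qed.
Let uH := half_edges_uniq n d.

Let sizePs : size Ps = num_pairings N.
Proof. by rewrite /Ps /pairings size_pairings // sizeH. Qed.

Lemma nonneg_cfg_law : nonneg cfg_law.
Proof.
have Ps0 : (0 < size Ps)%N by rewrite sizePs num_pairings_gt0.
have [n0|n0] := posnP n.
  rewrite /nonneg /cfg_law n0 /dbind; elim: (unif R Ps) => //= q s IH.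
have [h _] : prob cfg_law => //.
apply: prob_bind => [|p _]; first exact: prob_unif.
by apply/prob_map/prob_unif; rewrite size_iota.
Qed.

(** Half-edges of disclosed vertices that lie in no followed pair. A pair that joins two disclosed
    vertices without being recorded must lie inside this set. *)
Let free r := [seq h <- heads r | h \notin ends (unzip2 (rvl r))].

Lemma heads_size r : inv r -> (size (heads r) <= degs d r)%N.
Proof.
move=> I.
have -> : degs d r = size (flatten [seq [seq (k, i) | i <- iota 0 (d k)] | k <- labs r]).
  rewrite size_flatten /shape -map_comp sumnE big_map; apply: eq_bigr => k _.
  by rewrite /= size_map size_iota.
apply: uniq_leq_size; first exact: (inv_heads I).
move=> h; rewrite (inv_mem_heads I) => /andP[hl hd].
apply/flatten_mapP; exists h.1 => //; apply/mapP; exists h.2; last by case: h {hl hd}.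
by rewrite mem_iota.
Qed.

Lemma rvl_ends_uniq r : inv r -> uniq (ends (unzip2 (rvl r))).
Proof.
move=> I; have := inv_heads I; rewrite !cat_uniq => /and3P[uA AB uB].
rewrite /ends /unzip1 /unzip2 -!map_comp uB andbT; apply/andP; split.
  rewrite (_ : map _ _ = [seq (nth e0 (ent r) j).1.2 | j <- unzip1 (rvl r)]); last first.
    rewrite -map_comp; apply/eq_in_map => x /(inv_rvl I)[_ h] /=; exact: h.
  rewrite map_inj_in_uniq ?(inv_opened I) // => j j' /mapP[x xr ->] /mapP[y yr ->] h.
  have := ent_head_inj I (rvl_nth I xr) (rvl_nth I yr) h.
  have [xl _] := inv_rvl I xr; have [yl _] := inv_rvl I yr => /(congr1 snd).
  exact: (inv_nth_inj I xl yl).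
apply: contra AB => /hasP[z zB /mapP[x xr zE]]; apply/hasP; exists z => //.
rewrite /= zE /=; have [_ ->] := inv_rvl I xr.
exact: (map_f (fun e => e.1.2) (rvl_nth I xr)).
Qed.

Lemma rvl_ends_sub r : inv r -> {subset ends (unzip2 (rvl r)) <= heads r}.
Proof.
move=> I z; rewrite mem_cat /unzip1 /unzip2 -!map_comp => /orP[] /mapP[x xr ->] /=.
  have [_ ->] := inv_rvl I xr; exact: (ent_head_mem I (rvl_nth I xr)).
exact: (rvl_head_mem I).
Qed.

Lemma count_cfg_good r : inv r ->
  (num_pairings (N - 2 * size (rvl r)) <=
   count (fun p => cfg_good n d (p, head 0%N (labs r)) r) Ps +
   degs d r ^ 2 * num_pairings (N - 2 * size (rvl r) - 2))%N.
Proof.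
move=> I; set s := unzip2 (rvl r).
have us : uniq (ends s) := rvl_ends_uniq I.
have ss : {subset ends s <= heads r} := rvl_ends_sub I.
have uF : uniq (ends s ++ free r).
  rewrite cat_uniq us filter_uniq ?(inv_heads I) // andbT.
  by apply/hasPn => z; rewrite mem_filter => /andP[].
have sF : {subset ends s ++ free r <= half_edges n d}.
  move=> z; rewrite mem_cat => zz; apply: (heads_half_edges I).
  by case/orP: zz => [/ss //|]; rewrite mem_filter => /andP[].
have SN : (size (half_edges n d) <= N)%N by rewrite sizeH.
rewrite /Ps /pairings sizeH.
have := count_pairings_avoid SN uH uF sF; rewrite sizeH size_map.
move=> h; apply: leq_trans h _; apply: leq_add; last first.
  rewrite leq_mul2r leq_sqr; apply/orP; right.
  by apply: leq_trans (heads_size I); rewrite size_filter count_size.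
rewrite (@eq_in_count _ _ (predI (fun p => all (fun q => paired p q.1 q.2) s &&
   all (fun q => ~~ ((q.1 \in free r) && (q.2 \in free r))) p)
   (mem (pairings_aux N (half_edges n d))))); last first.
  by move=> p pp /=; rewrite pp andbT.
apply: sub_count => p /= /andP[/andP[ps pf] pp].
have gp : perm_eq (ends p) (half_edges n d) := mem_pairings SN uH pp.
have up : uniq (ends p) by rewrite (perm_uniq gp).
apply/and4P; split=> //=; first by move: ps; rewrite all_map.
apply/allP => q qp; apply/implyP => /andP[l1 l2].
have qh h : has_end h q -> h.1 \in labs r -> h \in heads r.
  move=> hq hl; rewrite (inv_mem_heads I) hl /=.
  have : h \in half_edges n d by rewrite -(perm_mem gp); apply/mem_endsP; exists q.
  by rewrite half_edges_mem => /andP[].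
have h1 : q.1 \in heads r by apply: qh => //; rewrite /has_end eqxx.
have h2 : q.2 \in heads r by apply: qh => //; rewrite /has_end eqxx orbT.
(* One end of [q] is not free, so it belongs to a recorded pair; as it lies in only one pair of [p],
   that pair is [q] up to orientation. *)
have [h hq hs] : exists2 h, has_end h q & h \in ends s.
  have := allP pf q qp; rewrite !mem_filter h1 h2 !andbT negb_and !negbK.
  by case/orP => h; [exists q.1|exists q.2]; rewrite // /has_end eqxx ?orbT.
have [x xs hx] := mem_endsP _ _ hs.
have [y yr xE] := mapP xs.
apply/hasP; exists y => //; rewrite -xE.
have : (x \in p) || (swap x \in p).
  by have := allP ps x xs; rewrite /paired -surjective_pairing.
have loc z : z \in p -> has_end h z -> q = z.
  move=> zp hz; rewrite -(nth_index q0 qp) -(nth_index q0 zp); congr nth.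
  by apply: (has_end_inj (x0 := q0) up (a := h)); rewrite ?index_mem ?nth_index.
case/orP => xp; first by rewrite (loc x) ?eqxx.
by rewrite (loc (swap x)) ?eqxx ?orbT //; move: hx; rewrite /has_end orbC.
Qed.

Lemma cfg_mass r : inv r ->
  (1 - eta) * n%:R^-1 * N%:R^-1 ^+ (size (labs r)).-1 <=
  label_weight (fun=> 1) (fun=> 1) r * Ex cfg_law (fun w => (cfg_good n d w r)%:R).
Proof.
move=> I; rewrite /label_weight big1 // mulr1 mul1r.
rewrite /cfg_law Ex_bind Ex_unif.
have hn : (head 0%N (labs r) < n)%N.
  by apply: (inv_lt I); have := inv_size I; case: (labs r) => // *; apply: mem_head.
have E p : Ex (dmap (pair p) (unif R (iota 0 n))) (fun w => (cfg_good n d w r)%:R) =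
    n%:R^-1 * (cfg_good n d (p, head 0%N (labs r)) r)%:R.
  rewrite Ex_map Ex_unif size_iota; congr (_ * _).
  rewrite (bigD1_seq (head 0%N (labs r))) ?iota_uniq ?mem_iota //= big1 ?addr0 // => o oh.
  by rewrite /cfg_good /= (negbTE oh) andbF.
under eq_bigr do rewrite E.
rewrite -big_distrr /= sizePs.
have -> : \sum_(p <- Ps) (cfg_good n d (p, head 0%N (labs r)) r)%:R =
   (count (fun p => cfg_good n d (p, head 0%N (labs r)) r) Ps)%:R :> R.
  rewrite -sum1_count natr_sum [RHS]big_mkcond /=; apply: eq_bigr => p _.
  by case: (cfg_good _ _ _ _).
have := count_cfg_good I; set X := count _ _; set m := size (rvl r).
have -> : (size (labs r)).-1 = m by rewrite (inv_size I).
set D1 := num_pairings (N - 2 * m); set D2 := num_pairings _ => hX.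
have mH : (2 * m <= degs d r)%N.
  rewrite -[m](size_map snd) -size_ends; apply: leq_trans (heads_size I).
  by apply: uniq_leq_size; [exact: rvl_ends_uniq|exact: rvl_ends_sub].
have HB := inv_degs I.
have mN : (2 * m < N)%N.
  rewrite -(ltr_nat R); apply: lt_le_trans B_lt.
  have : (2 * m)%:R <= (degs d r)%:R :> R by rewrite ler_nat.
  by lra.
(* [D2] counts the matchings with one further pair prescribed. The ratio [N - 2m - 1] of [D1] to
   [D2] turns the subtracted term of the union bound into at most [eta * D1]. *)
have D12 : D1 = ((N - 2 * m - 1) * D2)%N.
  rewrite /D1 /D2; have : ~~ odd (N - 2 * m) by rewrite oddB ?(ltnW mN) // mul2n odd_double addbF.
  have : (0 < N - 2 * m)%N by lia.
  by case: (N - 2 * m)%N => [|[|k]] // _ _; rewrite num_pairingsSS !subSS !subn0.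
have D0 := num_pairings_gt0 N_even.
have D0le := num_pairings_le (ltnW mN); rewrite -/D1 in D0le.
have sq : (degs d r ^ 2)%:R <= eta * (N - 2 * m - 1)%:R :> R.
  have -> : (N - 2 * m - 1)%:R = N%:R - (2 * m)%:R - 1 :> R.
    by rewrite !natrB ?(ltnW mN) // subn_gt0.
  have m2 : (2 * m)%:R <= (degs d r)%:R :> R by rewrite ler_nat.
  apply: le_trans (_ : _ <= B ^+ 2) _.
    by rewrite natrX ler_sqr ?nnegrE ?ler0n.
  apply: le_trans B_small _; apply: ler_wpM2l => //; lra.
have Xge : (1 - eta) * D1%:R <= X%:R :> R.
  have : D1%:R <= X%:R + (degs d r ^ 2)%:R * D2%:R :> R by rewrite -natrM -natrD ler_nat.
  have : (degs d r ^ 2)%:R * D2%:R <= eta * D1%:R :> R.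
    by rewrite D12 natrM mulrA ler_wpM2r.
  by rewrite mulrBl mul1r; lra.
have N0 : 0 < N%:R :> R by rewrite ltr0n; lia.
have D0R : 0 < (num_pairings N)%:R :> R by rewrite ltr0n.
rewrite mulrAC mulrC [X in _ <= X]mulrCA ler_wpM2l ?invr_ge0 //.
rewrite ler_pdivlMl // mulrCA; apply: (le_trans _ Xge); rewrite ler_wpM2l ?subr_ge0 //.
rewrite exprVn ler_pdivrMr ?exprn_gt0 // mulrC -natrX -natrM ler_nat.
exact: D0le.
Qed.

End ConfigMass.

(** * The branching process *)

Lemma Ex_ge_point (R : realType) (T : eqType) (mu : dist R T) (f : T -> R) x :
  nonneg mu -> (forall y, 0 <= f y) -> Ex mu (fun y => (y == x)%:R) * f x <= Ex mu f.
Proof.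
move=> mu0 f0; rewrite -ExZr; apply: le_Ex => // y.
by case: eqP => [->|_]; rewrite ?mul1r ?mul0r.
Qed.

Lemma prefix_rcons_nth u i (w : seq nat) : prefix (rcons u i) w -> nth 0%N w (size u) = i.
Proof. by move=> /prefixP[s ->]; rewrite cat_rcons nth_cat ltnn subnn. Qed.

Lemma prefix_rcons_neq u i (w : seq nat) : prefix (rcons u i) w -> u != w.
Proof.
move=> /prefixP[s ->]; apply/eqP => /(congr1 size).
by rewrite size_cat size_rcons; lia.
Qed.

Lemma prefix_rconsW u i (w : seq nat) : prefix (rcons u i) w -> prefix u w.
Proof. by move=> /prefixP[s ->]; rewrite cat_rcons prefix_prefix. Qed.

Lemma prefix_proper u (w : seq nat) : prefix u w -> u != w ->
  exists i, prefix (rcons u i) w.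
Proof.
move=> /prefixP[[|i s] ->]; first by rewrite cats0 eqxx.
by exists i; rewrite -cat_rcons prefix_prefix.
Qed.

Section Generation.
Variables (R : realType) (offs : dist R nat).
Hypothesis offs_prob : prob offs.
Notation word := (seq nat).
Notation edge := (word * word)%type.

Definition kids (w : word) c : seq edge := [seq (w, rcons w i) | i <- iota 0 c].

Definition out_edges (w : word) (t : seq edge) := [seq e <- t | e.1 == w].

Definition is_tree_edge (e : edge) := e.2 == rcons e.1 (last 0%N e.2).

Definition gw_step h u i (acc : dist R (seq edge)) : dist R (seq edge) :=
  dbind offs (fun c' =>
  dbind (gw_gen offs h (rcons u i) c') (fun t =>
  dbind acc (fun rest => dret R ((u, rcons u i) :: t ++ rest)))).

Lemma gw_genS h u c :
  gw_gen offs h.+1 u c = foldr (gw_step h u) (dret R [::]) (iota 0 c).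
Proof. by []. Qed.

Lemma prob_gw_fold h u s :
  (forall u c, prob (gw_gen offs h u c)) -> prob (foldr (gw_step h u) (dret R [::]) s).
Proof.
move=> H; elim: s => [|i s IH] /=; first exact: prob_ret.
apply: prob_bind => // p _; apply: prob_bind => // q _; apply: prob_bind => // p' _.
exact: prob_ret.
Qed.

Lemma prob_gw_gen h u c : prob (gw_gen offs h u c).
Proof.
elim: h u c => [|h IH] u c; first exact: prob_ret.
by rewrite gw_genS; apply: prob_gw_fold.
Qed.

(* [wc] lists the words of a finite subtree with their numbers of children. *)
Variable wc : seq (word * nat).
Hypothesis wc_uniq : uniq (unzip1 wc).
Hypothesis wc_closed : forall x, x \in wc ->
  x.1 = [::] \/ exists y i, [/\ y \in wc, (i < y.2)%N & x.1 = rcons y.1 i].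

Definition pc c := Ex offs (fun c' => (c' == c)%:R).

Lemma pc_ge0 c : 0 <= pc c.
Proof. by apply: Ex_ge0 => [|c']; [case: offs_prob|rewrite ler0n]. Qed.

(* The support conditions are part of the events, so that only lower bounds on
   probabilities are needed. *)
Let G u (t : seq edge) :=
  all (fun e => prefix u e.1 && is_tree_edge e) t &&
  all (fun x => prefix u x.1 ==> (out_edges x.1 t == kids x.1 x.2)) wc.

Let Gs u s (t : seq edge) :=
  [&& all (fun e => is_tree_edge e &&
            ((e.1 == u) || has (fun i => prefix (rcons u i) e.1) s)) t,
      out_edges u t == [seq (u, rcons u i) | i <- s] &
      all (fun x => has (fun i => prefix (rcons u i) x.1) s ==>
             (out_edges x.1 t == kids x.1 x.2)) wc].

Lemma wc_inj x y : x \in wc -> y \in wc -> x.1 = y.1 -> x = y.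
Proof.
move: wc_uniq; elim: (wc) => //= z s IH /andP[zs us].
rewrite !inE => /orP[/eqP ->|xs] /orP[/eqP ->|ys] // h; last exact: IH.
  by case/mapP: zs; exists y.
by case/mapP: zs; exists x.
Qed.

Lemma wc_prefix_closed u i x : x \in wc -> prefix (rcons u i) x.1 ->
  exists2 y, y \in wc & y.1 = rcons u i.
Proof.
move: {2}(size x.1) (leqnn (size x.1)) => m; elim: m x => [|m IH] x.
  by rewrite leqn0 size_eq0 => /eqP xE _ /prefixP[s]; rewrite xE; case: (u).
move=> xm xw pre; have [/eqP h|ne] := boolP (x.1 == rcons u i); first by exists x.
have [xE|[y [j [yw _ xE]]]] := wc_closed xw.
  by move: pre => /prefixP[s]; rewrite xE; case: (u).
apply: (IH y) => //; first by move: xm; rewrite xE size_rcons.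
move/prefixP: pre ne => [s]; case/lastP: s => [|s k] h; first by rewrite h cats0 eqxx.
move=> _; rewrite -rcons_cat xE in h; have [-> _] := rcons_inj h.
by rewrite prefix_prefix.
Qed.

Lemma wc_parent u i x : x \in wc -> prefix (rcons u i) x.1 ->
  exists y, [/\ y \in wc, y.1 = u & (i < y.2)%N].
Proof.
move=> xw pre; have [y yw yE] := wc_prefix_closed xw pre.
have [h|[z [j [zw jz]]]] := wc_closed yw; first by rewrite h in yE; case: (u) yE.
by rewrite yE => /rcons_inj[-> ->]; exists z.
Qed.

Let G_of_Gs u c t :
  (u, c) \in wc \/ ~~ has (fun x => prefix u x.1) wc ->
  Gs u (iota 0 c) t -> G u t.
Proof.
move=> uwc /and3P[/allP g1 /eqP g2 /allP g3]; apply/andP; split.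
  apply/allP => e et; have /andP[-> h] := g1 e et; rewrite andbT.
  case/orP: h => [/eqP ->|/hasP[i _ /prefix_rconsW //]].
  by rewrite -[X in prefix _ X]cats0 prefix_prefix.
apply/allP => x xw; apply/implyP => pre.
have uc : (u, c) \in wc.
  by case: uwc => // /hasPn /(_ x xw); rewrite pre.
have [xu|ux] := eqVneq u x.1.
  by rewrite (wc_inj xw uc) ?g2.
have [i pi] := prefix_proper pre ux.
have [y [yw yu iy]] := wc_parent xw pi.
have yE := wc_inj yw uc yu.
apply: (implyP (g3 x xw)); apply/hasP; exists i => //.
by rewrite mem_iota add0n; move: iy; rewrite yE.
Qed.

Let out_edges_cat w s t : out_edges w (s ++ t) = out_edges w s ++ out_edges w t.
Proof. exact: filter_cat. Qed.

Let out_edges_nil w (t : seq edge) : (forall e, e \in t -> e.1 != w) -> out_edges w t = [::].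
Proof.
move=> h; apply/eqP; rewrite -(negbK (_ == _)) -has_filter; apply/hasPn => e; exact: h.
Qed.

(** The letter at position [size u] tells through which child of [u] a word passes, so the edges of
    [t] and those of [rest] do not interfere. *)
Let Gs_cons u i s t rest : i \notin s -> G (rcons u i) t -> Gs u s rest ->
  Gs u (i :: s) ((u, rcons u i) :: t ++ rest).
Proof.
move=> is_ /andP[/allP g1 /allP g2] /and3P[/allP h1 /eqP h2 /allP h3].
apply/and3P; split.
- rewrite /= eqxx (_ : is_tree_edge _) /= ?all_cat; last by rewrite /is_tree_edge /= last_rcons.
   apply/andP; split.
    by apply/allP => e et; have /andP[-> ->] := g1 e et; rewrite orbT.
  by apply/allP => e er; have /andP[-> /orP[->|->]] := h1 e er; rewrite ?orbT.
- rewrite /out_edges /= eqxx -/(out_edges _ _) out_edges_cat h2 out_edges_nil // => e et.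
  by have /andP[/prefix_rcons_neq h _] := g1 e et; rewrite eq_sym.
- apply/allP => x xw; apply/implyP => /=; rewrite /out_edges /= -/(out_edges _ _).
  case/orP => [pre|/hasP[k ks pre]].
    rewrite (negbTE (prefix_rcons_neq pre)) out_edges_cat.
    rewrite (eqP (implyP (g2 x xw) pre)) (@out_edges_nil _ rest) ?cats0 // => e er.
    apply/eqP => ex.
    have /andP[_ /orP[/eqP eu|/hasP[k ks]]] := h1 e er.
      by move: (prefix_rcons_neq pre); rewrite -ex eu eqxx.
    rewrite ex => /prefix_rcons_nth ik; move/negP: is_; apply.
    by rewrite -(prefix_rcons_nth pre) ik.
  rewrite (negbTE (prefix_rcons_neq pre)) out_edges_cat.
  rewrite (@out_edges_nil _ t) => [|e et]; last first.
    apply/eqP => ex; have /andP[+ _] := g1 e et; rewrite ex => /prefix_rcons_nth ik.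
    by move/negP: is_; apply; rewrite -ik (prefix_rcons_nth pre).
  by apply: (implyP (h3 x xw)); apply/hasP; exists k.
Qed.

Let offs_ge0 : nonneg offs. Proof. by case: offs_prob. Qed.

(** Either [u] is prescribed with [c] children, or nothing at or below [u] is prescribed; then [c]
    is arbitrary and the product is empty. The factor of [u] itself is left out because [c] is
    given. The depth condition ensures that the children of every prescribed word below [u] are
    generated. Inside the induction on the height, a second one runs over the children, whose
    branches are independent. *)
Lemma gw_gen_mass h u c :
  (u, c) \in wc \/ ~~ has (fun x => prefix u x.1) wc ->
  (forall x, x \in wc -> prefix u x.1 -> (size x.1 < size u + h)%N) ->
  \prod_(x <- wc | prefix u x.1 && (x.1 != u)) pc x.2 <=
  Ex (gw_gen offs h u c) (fun t => (G u t)%:R).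
Proof.
elim: h u c => [|h IH] u c uwc uh.
  have none : ~~ has (fun x => prefix u x.1) wc.
    case: uwc => // uw; have := uh _ uw; rewrite -[X in prefix _ X]cats0 prefix_prefix.
    by rewrite addn0 ltnn => /(_ isT).
  rewrite big_seq_cond big1 => [|x /and3P[xw pre _]]; last first.
    by move/hasPn: none => /(_ x xw); rewrite pre.
  rewrite Ex_ret (_ : G u [::]) //; apply/allP => x xw.
  by move/hasPn: none => /(_ x xw) /negbTE ->.
have fold_le s : uniq s ->
  \prod_(x <- wc | has (fun i => prefix (rcons u i) x.1) s) pc x.2 <=
  Ex (foldr (gw_step h u) (dret R [::]) s) (fun t => (Gs u s t)%:R).
  elim: s => [|i s IHs].
    by move=> _; rewrite big_pred0 // Ex_ret (_ : Gs u [::] [::]) //; apply/allP.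
  move=> /andP[is_ us]; have {}IHs := IHs us.
  have [f0 _] : prob (foldr (gw_step h u) (dret R [::]) s).
    exact: prob_gw_fold (@prob_gw_gen h).
  set A := Ex (foldr _ _ s) _ in IHs.
  have step : Ex offs (fun c' => Ex (gw_gen offs h (rcons u i) c')
       (fun t => (G (rcons u i) t)%:R)) * A <=
     Ex (foldr (gw_step h u) (dret R [::]) (i :: s)) (fun t => (Gs u (i :: s) t)%:R).
    rewrite -ExZr /= /gw_step Ex_bind; apply: le_Ex => // c'.
    rewrite -ExZr Ex_bind; apply: le_Ex => [|t]; first by have [] := prob_gw_gen h (rcons u i) c'.
    rewrite Ex_bind -ExZl; apply: le_Ex => // rest; rewrite Ex_ret.
    case g1 : (G _ t); rewrite ?mul0r ?ler0n // mul1r.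
    by case g2 : (Gs u s rest); rewrite ?ler0n // Gs_cons.
  apply: le_trans step.
  have -> : \prod_(x <- wc | has (fun k => prefix (rcons u k) x.1) (i :: s)) pc x.2 =
     \prod_(x <- wc | prefix (rcons u i) x.1) pc x.2 *
     \prod_(x <- wc | has (fun k => prefix (rcons u k) x.1) s) pc x.2.
    rewrite (bigID (fun x => prefix (rcons u i) x.1)) /=; congr (_ * _); apply: eq_bigl => x.
      by case: (prefix (rcons u i) _); rewrite ?andbF.
    case pre : (prefix (rcons u i) _); rewrite ?andbF ?andbT //=.
    apply/esym/negbTE/hasPn => k ks; apply: contraNN is_ => pre'.
    by rewrite -(prefix_rcons_nth pre) (prefix_rcons_nth pre').
  apply: ler_pM => //; try by apply: prodr_ge0 => *; exact: pc_ge0.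
  have hs x : x \in wc -> prefix (rcons u i) x.1 -> (size x.1 < size (rcons u i) + h)%N.
    by move=> xw /prefix_rconsW /(uh x xw); rewrite size_rcons; lia.
  (* If the branch contains a prescribed word, [rcons u i] is itself prescribed. Restricting its
     offspring to the prescribed value pays the one factor that the inductive bound omits. Otherwise
     every offspring number is admissible. *)
  case: (boolP (has (fun x => prefix (rcons u i) x.1) wc)) => [/hasP[x xw pre]|none].
    have [y yw yE] := wc_prefix_closed xw pre.
    have := IH (rcons u i) y.2 _ hs; rewrite -{1}yE -surjective_pairing => /(_ (or_introl yw)) h1.
    apply: le_trans (Ex_ge_point y.2 offs_ge0 _); last first.
      move=> c'; apply: Ex_ge0 => [|t]; last by rewrite ler0n.
      by have [] := prob_gw_gen h (rcons u i) c'.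
    rewrite (bigID (fun x => x.1 != rcons u i)) /= mulrC; apply: ler_pM => //.
    - by apply: prodr_ge0 => *; exact: pc_ge0.
    - by apply: prodr_ge0 => *; exact: pc_ge0.
    have uw : uniq wc by apply: map_uniq wc_uniq.
    rewrite (big_rem y yw) /=.
    rewrite yE eqxx /= -[X in prefix _ X]cats0 prefix_prefix /=.
    rewrite big_seq_cond big1 ?mulr1 //.
    move=> z /and3P[zw pz]; rewrite negbK => /eqP zE.
    move: zw; rewrite mem_rem_uniq // inE => /andP[/eqP zy zw]; case: zy.
    by apply: wc_inj; rewrite ?zE ?yE.
  rewrite big_seq_cond big1 => [|x /andP[xw pre]]; last first.
    by move/hasPn: none => /(_ x xw); rewrite pre.
  have [_ e1] := offs_prob; rewrite -[X in X <= _]e1; apply: le_Ex => // c'.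
  apply: (le_trans _ (IH (rcons u i) c' (or_intror none) hs)).
  rewrite big_seq_cond big1 // => x /and3P[xw pre _].
  by move/hasPn: none => /(_ x xw); rewrite pre.
rewrite gw_genS; apply: le_trans (_ : _ <= Ex _ (fun t => (Gs u (iota 0 c) t)%:R)) _; last first.
  apply: le_Ex => [|t]; first by have [] := prob_gw_gen h.+1 u c; rewrite gw_genS.
  by case g : (Gs _ _ _); rewrite ?ler0n // (G_of_Gs uwc g).
apply: le_trans (fold_le _ (iota_uniq _ _)).
rewrite le_eqVlt; apply/orP; left; apply/eqP.
rewrite big_seq_cond [RHS]big_seq_cond; apply: eq_bigl => x.
case xw : (x \in wc) => //=; apply/andP/hasP => [[pre ne]|[i _ pre]].
  have [|i pi] := prefix_proper pre; first by rewrite eq_sym.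
  have [y [yw yu iy]] := wc_parent xw pi.
  exists i => //; rewrite mem_iota add0n /=.
  case: uwc => [uw|/hasPn /(_ x xw)]; last by rewrite pre.
  by move: iy; rewrite (wc_inj yw uw yu).
by split; [exact: prefix_rconsW pre|rewrite eq_sym; exact: prefix_rcons_neq pre].
Qed.

Lemma gw_root_mass h c : ([::], c) \in wc ->
  (forall x, x \in wc -> (size x.1 < h)%N) ->
  \prod_(x <- wc | x.1 != [::]) pc x.2 <=
  Ex (gw_gen offs h [::] c) (fun t => (all is_tree_edge t &&
     all (fun x => out_edges x.1 t == kids x.1 x.2) wc)%:R).
Proof.
move=> cw hh; have H := @gw_gen_mass h [::] c (or_introl cw) (fun x xw _ => hh x xw).
rewrite (_ : \prod_(x <- wc | _) _ =
  \prod_(x <- wc | prefix [::] x.1 && (x.1 != [::])) pc x.2); last by apply: eq_bigl => x; rewrite prefix0s.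
apply: (le_trans H).
apply: le_Ex => [|t]; first by have [] := prob_gw_gen h [::] c.
rewrite /G; case g : (_ && _); rewrite ?ler0n //.
by case/andP: g => /allP g1 /allP g2; rewrite (_ : _ && _) //;
  apply/andP; split; apply/allP => e he; [have /andP[] := g1 e he|have := g2 e he; rewrite prefix0s].
Qed.

End Generation.

(** * The branching tree as a model of the labelled process *)

Section TreeModel.
Variables (R : realType) (n : nat) (d : nat -> nat) (B : R).
Notation inv := (inv n d B).
Notation word := (seq nat).
Notation edge := (word * word)%type.
Let N : R := (deg_sum n d)%:R.

Notation offs := (law_Dstar_minus1 R n d).

Definition gw_good (t : seq edge) r :=
  all is_tree_edge t &&
  all (fun q => out_edges (nth [::] (wds r) q) t == kids (nth [::] (wds r) q) (cnt d r q))
      (iota 0 (size (labs r))).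

Definition gw_gam (t : seq edge) r : seq nat :=
  [seq find (fun x => x.2 == e.2) t | e <- ent r].

Definition gw_st (t : seq edge) r : seq word * seq nat :=
  (wds r, [seq nth 0%N (gw_gam t r) j | j <- chs r]).

Definition et0 : edge := ([::], [::]).

Lemma gedge_et0 t i : gedge [::] t i = nth et0 t i. Proof. by []. Qed.

Section Good.
Variables (t : seq edge) (r : rst).
Hypotheses (I : inv r) (gr : gw_good t r).

Let gw_edge e : e \in t -> e.2 = rcons e.1 (last 0%N e.2).
Proof. by case/andP: gr => /allP h _ /h /eqP. Qed.

Let gw_out q : (q < size (labs r))%N ->
  out_edges (nth [::] (wds r) q) t = kids (nth [::] (wds r) q) (cnt d r q).
Proof. by case/andP: gr => _ /allP h ql; apply/eqP/h; rewrite mem_iota. Qed.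

Lemma gw_find e : e \in ent r ->
  (find (fun x => x.2 == e.2) t < size t)%N /\
  nth et0 t (find (fun x => x.2 == e.2) t) = (nth [::] (wds r) e.1.1, e.2).
Proof.
move=> er; have [h1 h2 [i il eE]] := inv_ent I er.
have et : (nth [::] (wds r) e.1.1, e.2) \in t.
  have : (nth [::] (wds r) e.1.1, e.2) \in out_edges (nth [::] (wds r) e.1.1) t.
    by rewrite gw_out // eE; apply/mapP; exists i; rewrite ?mem_iota.
  by rewrite mem_filter => /andP[].
have hp : has (fun x => x.2 == e.2) t by apply/hasP; eexists; first exact: et.
have fl : (find (fun x => x.2 == e.2) t < size t)%N by rewrite -has_find.
split=> //; have /= := nth_find et0 hp => /eqP xE.
have := gw_edge (mem_nth et0 fl); rewrite xE {1}eE => /rcons_inj[h _].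
by rewrite [LHS]surjective_pairing -h xE.
Qed.

(** Nothing forbids repetitions in an arbitrary list [t]. Below a disclosed word, however, the edges
    are exactly those in [kids], which are distinct. *)
Lemma gw_nth_inj i i' : (i < size t)%N -> (i' < size t)%N ->
  (nth et0 t i).1 \in wds r -> nth et0 t i = nth et0 t i' -> i = i'.
Proof.
wlog le : i i' / (i <= i')%N.
  move=> H il il' iw ii; case/orP: (leq_total i i') => h; first exact: H.
  by apply/esym/H => //; rewrite -?ii.
move=> il il' iw ii; apply/eqP; rewrite eqn_leq le leqNgt; apply/negP => lt.
have : (count_mem (nth et0 t i) t <= 1)%N.
  have -> : count_mem (nth et0 t i) t =
            count_mem (nth et0 t i) (out_edges (nth et0 t i).1 t).
    rewrite count_filter; apply: eq_count => x /=.
    by case: eqP => // ->; rewrite eqxx.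
  have [q ql <-] := nthP [::] iw; rewrite (inv_size_wds I) in ql.
  rewrite gw_out //; apply: leq_trans (_ : (_ \in kids (nth [::] (wds r) q) (cnt d r q) : nat) <= 1)%N.
    rewrite count_uniq_mem // map_inj_uniq ?iota_uniq // => k k' [].
    by move=> /rcons_inj[].
  by case: (_ \in _).
rewrite -{2}(cat_take_drop i' t) count_cat.
have : (0 < count_mem (nth et0 t i) (take i' t))%N.
  by rewrite -has_count has_pred1 -(nth_take _ lt) mem_nth // size_take il'.
have : (0 < count_mem (nth et0 t i) (drop i' t))%N.
  rewrite -has_count has_pred1 ii -[i' in nth _ _ i']addn0 -nth_drop mem_nth //.
  by rewrite size_drop subn_gt0.
by lia.
Qed.

Lemma gw_matches : matches [::] t (gw_st t r) (zst r) (gw_gam t r).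
Proof.
have sg : size (gw_gam t r) = size (ent r) by rewrite size_map.
have sw := inv_size_wds I; have uw := inv_wds_uniq I.
have wmem e : e \in ent r -> nth [::] (wds r) e.1.1 \in wds r.
  by move=> /(inv_ent I)[h _ _]; rewrite mem_nth // sw.
split=> //=.
- by rewrite sw (inv_size I).
- by rewrite sg /ex_edges /= size_map size_iota.
- apply: uniq_perm; rewrite ?disclosed_edges_uniq //.
    rewrite map_inj_in_uniq => [|e e' er e'r he].
      by have := inv_words I; apply: map_uniq.
    have [_ h] := gw_find er; have [_] := gw_find e'r; rewrite -he h => -[_ h'].
    exact: (inv_word_inj I).
  move=> i; rewrite mem_disclosed gedge_et0; apply/mapP/andP => [[e er ->]|[il hi]].
    by have [il ->] := gw_find er; rewrite il wmem.
  (* Disclosed words are closed under taking parents, so an edge with any disclosed end has its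
     upper end disclosed. *)
  have w1 : (nth et0 t i).1 \in wds r.
    case/orP: hi => //; rewrite {1}(inv_wds I) inE => /orP[/eqP h|/mapP[x xr xE]].
      by have := gw_edge (mem_nth et0 il); rewrite h; case: (nth et0 t i).1.
    have er : nth e0 (ent r) x.1 \in ent r by apply: mem_nth; have [] := inv_rvl I xr.
    have := gw_edge (mem_nth et0 il); rewrite xE; have [_ _ [k _ ->]] := inv_ent I er.
    by move=> /rcons_inj[<- _]; apply: wmem.
  have [q ql qE] := nthP [::] w1; rewrite sw in ql.
  have : nth et0 t i \in out_edges (nth [::] (wds r) q) t.
    by rewrite mem_filter qE eqxx mem_nth.
  rewrite gw_out // => /mapP[k]; rewrite mem_iota add0n => /= kc kE.
  have [e er [eq eE]] := inv_children I ql kc.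
  exists e => //; have [fl fE] := gw_find er.
  by apply: gw_nth_inj => //; rewrite fE eq eE kE.
split=> //; last by move=> j /(inv_chs I); rewrite sg.
move=> j; rewrite sg => jl.
rewrite /ex_edge /ex_edges /= (nth_map 0%N) ?size_iota // nth_iota // add0n.
rewrite (nth_map e0) // gedge_et0; have er := mem_nth e0 jl.
have [_ ->] := gw_find er; have [h1 _ _] := inv_ent I er; left.
have -> : vpos (wds r) (nth [::] (wds r) (nth e0 (ent r) j).1.1) =
          Some (nth e0 (ent r) j).1.1.
  by rewrite /vpos wmem // index_uniq // sw.
congr (_, _); rewrite /child; case: ifP => jo; last first.
  by rewrite /vpos (negbTE (word_unopened I jl _)) ?jo.
have tl : (index j (unzip1 (rvl r)) < size (rvl r))%N by rewrite -(size_map fst) index_mem.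
have nE : nth [::] (wds r) (index j (unzip1 (rvl r))).+1 = (nth e0 (ent r) j).2.
  rewrite (inv_wds I) /= (nth_map (0%N, q0)) //; congr (nth _ _ _).2.
  by rewrite -(nth_map _ 0%N) // nth_index.
have tl' : ((index j (unzip1 (rvl r))).+1 < size (wds r))%N by rewrite sw (inv_size I).
by rewrite /vpos -nE mem_nth // index_uniq.
Qed.

End Good.

Lemma gw_reveal t r j b : inv r -> (j < size (ent r))%N ->
  ~~ opened r j -> gw_good t (reveal d r j b) ->
  gw_good t r /\ gw_st t (reveal d r j b) =
    next_state [::] t (gw_st t r) (nth 0%N (gw_gam t r) j).
Proof.
move=> I jl jo /andP[g1 g2].
have gr : gw_good t r.
  apply/andP; split=> //; apply/allP => q; rewrite mem_iota add0n => /= ql.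
  have := allP g2 q; rewrite mem_iota add0n /= size_rcons ltnS (ltnW ql) => /(_ isT).
  by rewrite cnt_reveal // !nth_rcons (inv_size_wds I) ql.
split=> //; have er := mem_nth e0 jl; have [h1 _ _] := inv_ent I er.
have gj : nth 0%N (gw_gam t r) j = find (fun x => x.2 == (nth e0 (ent r) j).2) t.
  by rewrite (nth_map e0).
rewrite /next_state gj gedge_et0; have [_ ->] := gw_find I gr er.
rewrite /gw_st /=; congr (_, _).
  rewrite {2}/add_vertex mem_nth ?(inv_size_wds I) // /add_vertex.
  by rewrite (negbTE (word_unopened I jl jo)).
rewrite map_rcons /gw_gam /= map_cat nth_cat size_map jl gj.
congr rcons; apply/eq_in_map => k /(inv_chs I) kl.
by rewrite nth_cat size_map kl.
Qed.

Hypothesis N_gt0 : 0 < N.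

Definition p_offs c : R := Ex offs (fun c' => (c' == c)%:R).
Definition p_root c : R := Ex (law_D R n d) (fun c' => (c' == c)%:R).
(* [N * p_offs (d k).-1] half-edges belong to vertices with the same offspring as [k]. *)
Definition gw_lam k := (N * p_offs (d k).-1)^-1.
Definition gw_lam0 k := (n%:R * p_root (d k))^-1.

Lemma nonneg_offs : nonneg offs.
Proof.
rewrite /nonneg all_map; elim: (iota 0 n) => //= k s ->.
by rewrite divr_ge0 ?ler0n.
Qed.

Lemma nonneg_law_D : nonneg (law_D R n d).
Proof.
rewrite /nonneg all_map; elim: (iota 0 n) => //= k s ->.
by rewrite invr_ge0 ler0n.
Qed.

Lemma deg_sum_iota : deg_sum n d = (\sum_(k <- iota 0 n) d k)%N.
Proof. by rewrite /deg_sum -(big_mkord xpredT) /index_iota subn0. Qed.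

Lemma n_gt0 : (0 < n)%N.
Proof.
rewrite lt0n; apply/eqP => n0; move: N_gt0.
by rewrite /N deg_sum_iota n0 big_nil ltxx.
Qed.

Lemma prob_offs : prob offs.
Proof.
split; first exact: nonneg_offs.
rewrite /Ex big_map /=; under eq_bigr do rewrite mulr1.
by rewrite -big_distrl /= -natr_sum -deg_sum_iota divff // gt_eqF.
Qed.

Lemma prob_law_D : prob (law_D R n d).
Proof.
split; first exact: nonneg_law_D.
rewrite /Ex big_map /= big_const_seq count_predT size_iota iter_addr addr0 mulr1.
by rewrite -[LHS]mulr_natr mulVf // pnatr_eq0 -lt0n n_gt0.
Qed.

Lemma p_offsE c : N * p_offs c = \sum_(h <- half_edges n d) ((d h.1).-1 == c)%:R.
Proof.
rewrite (sum_half_edges n d (fun k => ((d k).-1 == c)%:R)) /p_offs /Ex big_map big_distrr.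
apply: eq_bigr => k _ /=; rewrite -[RHS]mulr_natl -/N; field.
by rewrite gt_eqF.
Qed.

Lemma p_rootE c : n%:R * p_root c = \sum_(k <- iota 0 n) (d k == c)%:R.
Proof.
rewrite /p_root /Ex big_map big_distrr; apply: eq_bigr => k _ /=.
by rewrite mulrA divff ?mul1r // pnatr_eq0 -lt0n n_gt0.
Qed.

Lemma p_offs_ge0 c : 0 <= p_offs c.
Proof. by apply: Ex_ge0 => [|c']; [exact: nonneg_offs|rewrite ler0n]. Qed.

Lemma p_root_ge0 c : 0 <= p_root c.
Proof. by apply: Ex_ge0 => [|c']; [exact: nonneg_law_D|rewrite ler0n]. Qed.

Lemma gw_lam_ge0 k : 0 <= gw_lam k.
Proof. by rewrite invr_ge0 mulr_ge0 ?p_offs_ge0 // ltW. Qed.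

Lemma gw_lam0_ge0 k : 0 <= gw_lam0 k.
Proof. by rewrite invr_ge0 mulr_ge0 ?p_root_ge0. Qed.

(** The tree reveals only the number [c0] of children of the root. Exactly [n * p_root c0] labels
    have this degree, each with the inverse share, so the shares sum to 1, or to 0 if there is no
    such label. *)
Lemma gw_root_sum t :
  \sum_(k <- iota 0 n | (d k)%:R <= B) gw_lam0 k * (gw_good t (start d k))%:R <= 1.
Proof.
set c0 := size (out_edges [::] t).
apply: (@le_trans _ _ (\sum_(k <- iota 0 n) gw_lam0 k * (d k == c0)%:R)).
  rewrite big_mkcond; apply: ler_sum => k _.
  case: ifP => _; last by rewrite mulr_ge0 ?gw_lam0_ge0.
  apply: ler_wpM2l; first exact: gw_lam0_ge0.
  case g : (gw_good _ _) => //; case/andP: g => _ /= /andP[/eqP h _].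
  by rewrite /c0 h size_map size_iota /cnt /= subn0 eqxx.
rewrite (eq_bigr (fun k => (n%:R * p_root c0)^-1 * (d k == c0)%:R)); last first.
  by move=> k _; rewrite /gw_lam0; case: eqP => [->|]; rewrite ?mulr0.
rewrite -big_distrr /= -p_rootE; have [->|h] := eqVneq (n%:R * p_root c0) 0.
  by rewrite mulr0.
by rewrite mulVf.
Qed.

(** As for the root, with half-edges in place of vertices: the offspring [c0] of the revealed word
    is read off the tree, and [N * p_offs c0] half-edges lead to it. *)
Lemma gw_sum t r j : inv r -> (j < size (ent r))%N -> ~~ opened r j ->
  \sum_(b <- half_edges n d | allowed d B r b)
     gw_lam b.1 * (gw_good t (reveal d r j b))%:R <= (gw_good t r)%:R.
Proof.
move=> I jl jo; case gr : (gw_good t r); last first.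
  rewrite big1 // => b ab; case gb : (gw_good t (reveal _ _ _ _)); rewrite ?mulr0 //.
  by have [] := gw_reveal I jl jo gb; rewrite gr.
set c0 := size (out_edges (nth e0 (ent r) j).2 t).
apply: (@le_trans _ _ (\sum_(b <- half_edges n d) gw_lam b.1 * ((d b.1).-1 == c0)%:R)).
  rewrite big_mkcond; apply: ler_sum => b _.
  case: ifP => _; last by rewrite mulr_ge0 ?gw_lam_ge0.
  apply: ler_wpM2l; first exact: gw_lam_ge0.
  case g : (gw_good _ _) => //; case/andP: g => _ /allP /(_ (size (labs r))).
  have sl : (0 < size (labs r))%N by rewrite (inv_size I).
  rewrite mem_iota /= size_rcons leqnn cnt_reveal_last // nth_rcons (inv_size_wds I).
  rewrite ltnn eqxx => /(_ isT) /eqP h.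
  by rewrite /c0 h size_map size_iota eqxx.
rewrite (eq_bigr (fun b => (N * p_offs c0)^-1 * ((d b.1).-1 == c0)%:R)); last first.
  by move=> b _; rewrite /gw_lam; case: eqP => [->|]; rewrite ?mulr0.
rewrite -big_distrr /= -p_offsE; have [->|h] := eqVneq (N * p_offs c0) 0.
  by rewrite mulr0.
by rewrite mulVf.
Qed.

Definition gw_law L : dist R (seq edge) :=
  dbind (law_D R n d) (fun c => gw_gen offs L.+1 [::] c).

Lemma prob_gw_law L : prob (gw_law L).
Proof.
apply: prob_bind; first exact: prob_law_D.
by move=> p _; apply: prob_gw_gen; apply: prob_offs.
Qed.

Lemma p_root_gt0 k : (k < n)%N -> 0 < p_root (d k).
Proof.
move=> kn; have : 0 < n%:R * p_root (d k).
  rewrite p_rootE (bigD1_seq k) ?mem_iota ?iota_uniq //= eqxx.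
  by rewrite ltr_pwDl // sumr_ge0.
by rewrite pmulr_rgt0 // ltr0n n_gt0.
Qed.

Lemma p_offs_gt0 b : b \in half_edges n d -> 0 < p_offs (d b.1).-1.
Proof.
move=> bS; have : 0 < N * p_offs (d b.1).-1.
  rewrite p_offsE (bigD1_seq b) ?half_edges_uniq //= eqxx.
  by rewrite ltr_pwDl // sumr_ge0.
by rewrite pmulr_rgt0.
Qed.

(** The tree has the prescribed offspring numbers with probability at least [p_root] of the root
    degree times the product of the [p_offs]. The shares in [label_weight] cancel these factors and
    leave [1/n] and one [1/N] per followed edge. *)
Lemma gw_mass L r : inv r -> (size (labs r) <= L.+1)%N ->
  n%:R^-1 * N^-1 ^+ (size (labs r)).-1 <=
  label_weight gw_lam0 gw_lam r * Ex (gw_law L) (fun t => (gw_good t r)%:R).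
Proof.
move=> I sL; have sw := inv_size_wds I; have sl : (0 < size (labs r))%N by rewrite (inv_size I).
pose wc := [seq (nth [::] (wds r) q, cnt d r q) | q <- iota 0 (size (labs r))].
have wcm q : (q < size (labs r))%N -> (nth [::] (wds r) q, cnt d r q) \in wc.
  by move=> ql; apply: (map_f (fun q => (nth [::] (wds r) q, cnt d r q))); rewrite mem_iota.
have wc1 : unzip1 wc = wds r.
  by rewrite /unzip1 -map_comp -sw -[RHS](mkseq_nth [::]).
have wcu : uniq (unzip1 wc) by rewrite wc1; exact: (inv_wds_uniq I).
have wcc x : x \in wc -> x.1 = [::] \/ exists y i, [/\ y \in wc, (i < y.2)%N & x.1 = rcons y.1 i].
  move=> xw; have : x.1 \in wds r by rewrite -wc1 map_f.
  rewrite (inv_wds I) inE => /orP[/eqP ->|/mapP[y yr yE]]; first by left.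
  have [yl _] := inv_rvl I yr; have [h1 _ [i il eE]] := inv_ent I (mem_nth e0 yl).
  by right; do 2!eexists; split; [exact: wcm h1|exact: il|rewrite yE eE].
have c0E : cnt d r 0 = d (head 0%N (labs r)) by rewrite /cnt subn0 nth0.
have w0 : nth [::] (wds r) 0 = [::] by rewrite (inv_wds I).
have cw : ([::], d (head 0%N (labs r))) \in wc by rewrite -c0E -{1}w0 wcm.
(* The word at position [q <= L] has length at most [q], so its children belong to the generated
   [L.+1] levels. *)
have dep x : x \in wc -> (size x.1 < L.+1)%N.
  move=> /mapP[q]; rewrite mem_iota add0n => /= ql ->; rewrite ltnS.
  by apply: leq_trans (inv_depth I ql) _; lia.
have goodE t : gw_good t r = (all is_tree_edge t &&
     all (fun x => out_edges x.1 t == kids x.1 x.2) wc).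
  by rewrite /gw_good all_map.
have := gw_root_mass prob_offs wcu wcc cw dep.
have -> : \prod_(x <- wc | x.1 != [::]) pc offs x.2 =
    \prod_(k <- behead (labs r)) p_offs (d k).-1.
  rewrite /wc big_map; case E : (size (labs r)) sl => [|m] // _ /=.
  rewrite big_cons w0 eqxx /= (iotaDl 1 0) big_map.
  rewrite [RHS](big_nth 0%N) /index_iota subn0 size_behead E /=.
  rewrite big_seq_cond [RHS]big_seq; apply: eq_big => [q|q _].
    rewrite mem_iota add0n; case ql : (_ < m)%N; rewrite ?andbF //=.
    by rewrite -[X in _ != X]w0 nth_uniq ?(inv_wds_uniq I) ?sw ?E ?add1n.
  by rewrite nth_behead /cnt add1n subn1.
set P := \prod_(k <- _) _ => hP.
have hn : head 0%N (labs r) \in labs r by case: (labs r) sl => //= *; rewrite mem_head.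
have p0 := p_root_gt0 (inv_lt I hn).
have Pk k : k \in behead (labs r) -> 0 < p_offs (d k).-1.
  rewrite (inv_rlabs I) => /mapP[x xr ->]; apply: p_offs_gt0.
  exact/(heads_half_edges I)/(rvl_head_mem I).
have P0 : 0 < P.
  by rewrite /P big_seq; apply: prodr_gt0 => k; exact: Pk.
have mE : (size (labs r)).-1 = size (behead (labs r)) by rewrite size_behead.
have lwE : label_weight gw_lam0 gw_lam r =
   n%:R^-1 * N^-1 ^+ (size (labs r)).-1 * (p_root (d (head 0%N (labs r))) * P)^-1.
  have pE : \prod_(k <- behead (labs r)) gw_lam k = N^-1 ^+ (size (labs r)).-1 * P^-1.
    rewrite /gw_lam prodfV big_split /= big_const_seq count_predT iter_mulr mulr1.
    by rewrite invfM -exprVn mE.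
  by rewrite /label_weight pE /gw_lam0 !invfM; ring.
rewrite lwE -[X in X <= _]mulr1 -!mulrA; apply: ler_wpM2l; first by rewrite invr_ge0.
apply: ler_wpM2l; first by rewrite exprn_ge0 // invr_ge0 ltW.
rewrite mulrC ler_pdivlMr ?mul1r ?mulr_gt0 //.
rewrite /gw_law Ex_bind.
apply: (@le_trans _ _ (p_root (d (head 0%N (labs r))) *
   Ex (gw_gen offs L.+1 [::] (d (head 0%N (labs r)))) (fun t => (gw_good t r)%:R))).
  rewrite ler_wpM2l ?(ltW p0) //; apply: (le_trans hP).
  by apply: le_Ex => [|t]; [have [] := prob_gw_gen prob_offs L.+1 [::] (d (head 0%N (labs r)))|rewrite goodE].
apply: (Ex_ge_point (f := fun c => Ex (gw_gen offs L.+1 [::] c) (fun t => (gw_good t r)%:R))).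
  exact: nonneg_law_D.
move=> c; apply: Ex_ge0 => [|t]; last by rewrite ler0n.
by have [] := prob_gw_gen prob_offs L.+1 [::] c.
Qed.

End TreeModel.

(** * Survival of the reference process *)

Section ReferenceMass.
Variables (R : realType) (n : nat) (d : nat -> nat) (B : R).
Variable K : expl -> option nat -> R.
Hypothesis HK : exploration_rule K.
Notation inv := (inv n d B).
Notation S := (half_edges n d).
Let N : R := (deg_sum n d)%:R.

Lemma ref_valueD f1 f2 k r : ref_value n d B K (fun x => f1 x + f2 x) k r =
  ref_value n d B K f1 k r + ref_value n d B K f2 k r.
Proof.
elim: k r => //= k IH r; rewrite IH mulrDr addrACA -big_split; congr (_ + _).
apply: eq_bigr => j _ /=; rewrite -mulrDr; congr (_ * _); case: ifP => _; first exact: IH.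
by rewrite -mulrDr -big_split; congr (_ * _); apply: eq_bigr => b _.
Qed.

Lemma ref_totalD f1 f2 k : ref_total n d B K (fun x => f1 x + f2 x) k =
  ref_total n d B K f1 k + ref_total n d B K f2 k.
Proof.
rewrite /ref_total -mulrDr -big_split; congr (_ * _).
by apply: eq_bigr => i _; exact: ref_valueD.
Qed.

Variable s : R.
Hypotheses (N_gt0 : 0 < N) (B_gt0 : 0 < B) (B_le : B <= s).

Let md k : R := Num.min (d k)%:R s.
Let mu : R := N^-1 * \sum_(h <- S) md h.1.
(** Union bound plus Markov's inequality. With [k] steps left, a repeated label has probability at
    most [k * (B / N)]. The truncated degree sum starts at [h] and grows by at most [mu] per step in
    mean, so it exceeds [B] with probability at most [(h + k * mu) / B]. *)
Let bnd k h : R := 1 - k%:R * (B / N) - (h + k%:R * mu) / B.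

Let md_ge0 k : 0 <= md k.
Proof. by rewrite le_min ler0n ltW // (lt_le_trans B_gt0). Qed.

Let mu_ge0 : 0 <= mu.
Proof. by rewrite mulr_ge0 ?invr_ge0 ?sumr_ge0 // ltW. Qed.

Let bnd_mono k k' h h' : (k <= k')%N -> h <= h' -> bnd k' h' <= bnd k h.
Proof.
move=> kk hh; have kR : k%:R <= k'%:R :> R by rewrite ler_nat.
rewrite /bnd -!addrA lerD2l; apply: lerD; rewrite lerN2.
  by rewrite ler_wpM2r // divr_ge0 // ltW.
by rewrite ler_wpM2r ?invr_ge0 ?(ltW B_gt0) // lerD // ler_wpM2r.
Qed.

Let bnd_le k h : 0 <= h -> bnd k h <= 1.
Proof.
move=> h0; rewrite /bnd -addrA gerDl -opprD oppr_le0; apply: addr_ge0.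
  by apply: mulr_ge0 => //; apply: divr_ge0; apply: ltW.
by apply: divr_ge0; [apply: addr_ge0 => //; apply: mulr_ge0|apply: ltW].
Qed.

Let bnd_le0 k h : B <= h -> bnd k h <= 0.
Proof.
move=> hB; apply: le_trans (@bnd_mono 0 k B h _ hB) _ => //.
by rewrite /bnd !mul0r subr0 addr0 divff ?subrr // gt_eqF.
Qed.

(** Truncation at [s >= B] cannot hide an overshoot: a degree above [s] alone already contributes
    [B]. *)
Let md_ge_B k h : (B < (h + d k)%:R) -> B <= h%:R + md k.
Proof.
rewrite natrD /md => hB; case: (leP (d k)%:R s) => _; first exact: ltW.
by apply: le_trans B_le _; rewrite lerDr.
Qed.

Let md_eq k h : (h + d k)%:R <= B -> (h + d k)%:R = h%:R + md k.
Proof.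
move=> hB; rewrite natrD /md min_l //; apply: le_trans B_le; apply: le_trans hB.
by rewrite natrD lerDr.
Qed.

Lemma sum_labs r : inv r -> \sum_(h <- S) (h.1 \in labs r)%:R = (degs d r)%:R :> R.
Proof.
move=> I; rewrite (sum_half_edges n d (fun k => (k \in labs r)%:R)).
transitivity (\sum_(k <- [seq k <- iota 0 n | k \in labs r]) (d k)%:R : R).
  rewrite big_filter [RHS]big_mkcond; apply: eq_bigr => k _.
  by case: ifP => _; rewrite ?mul0rn.
rewrite /degs natr_sum; apply: perm_big; apply: uniq_perm.
- by rewrite filter_uniq ?iota_uniq.
- exact: (inv_labs I).
- move=> k; rewrite mem_filter mem_iota add0n /=.
  by case kl : (k \in labs r) => //=; exact: (inv_lt I).
Qed.

(* The bound is linear in the truncated degree sum, and nonpositive as soon as a step is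
   killed for exceeding [B], so only repeated labels cost [B / N] per step. *)
Lemma ref_value_ge k r : inv r ->
  bnd k (degs d r)%:R <= ref_value n d B K (fun=> 1) k r.
Proof.
elim: k r => [|k IH] r I /=; first exact: bnd_le.
have wz := zst_wf I; have [h1 _] := HK; have [K0 _ K1] := h1 _ wz.
have {}K1 : K (zst r) None + \sum_(j <- iota 0 (size (ent r))) K (zst r) (Some j) = 1.
  rewrite -[RHS]K1; congr (_ + _).
  by rewrite /ex_edges size_map size_iota -(big_mkord xpredT (fun j => K (zst r) (Some j)))
     /index_iota subn0.
rewrite -[X in X <= _]mul1r -[X in X * _ <= _]K1 mulrDl big_distrl /=; apply: lerD.
  by rewrite ler_wpM2l //; apply: le_trans (IH _ I); apply: bnd_mono.
rewrite big_seq [X in _ <= X]big_seq; apply: ler_sum => j.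
rewrite mem_iota add0n => /= jl; rewrite ler_wpM2l //; case: ifP => jo.
  by apply: le_trans (IH _ (inv_touch I jl)); apply: bnd_mono.
move/negbT in jo; set H : R := (degs d r)%:R.
(* Extends the sum to all half-edges. An overshoot costs nothing, as [bnd] is nonpositive there. A
   repeated label costs at most 1, and the half-edges with such labels number [degs d r <= B]. *)
apply: (@le_trans _ _ (N^-1 * \sum_(b <- S) (bnd k (H + md b.1) - (b.1 \in labs r)%:R))); last first.
  rewrite ler_wpM2l ?invr_ge0 ?(ltW N_gt0) // [X in _ <= X]big_mkcond.
  rewrite big_seq [X in _ <= X]big_seq; apply: ler_sum => b bS; case: ifP => ab.
    have := IH _ (inv_reveal I jl jo bS ab); rewrite degs_reveal; case/andP: ab => bl bB.
    by rewrite md_eq // (negbTE bl) subr0.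
  rewrite subr_le0; case bl : (b.1 \in labs r) ab => ab.
    by apply: bnd_le; rewrite addr_ge0.
  apply: bnd_le0; apply: md_ge_B; move: ab.
  by rewrite /allowed bl /= => /negbT; rewrite -ltNge.
have E b : bnd k (H + md b) = bnd k H - md b / B by rewrite /bnd !mulrDl; ring.
under eq_bigr do rewrite E.
rewrite sumrB sumrB big_const_seq count_predT iter_addr addr0 sum_labs // -mulr_suml.
rewrite size_half_edges !mulrBr.
have -> : N^-1 * (bnd k H *+ deg_sum n d) = bnd k H.
  by rewrite -[X in _ * X]mulr_natr mulrCA mulVf ?mulr1 // gt_eqF.
rewrite mulrA -/mu -/H.
have HB : N^-1 * H <= B / N.
  by rewrite mulrC ler_wpM2r ?invr_ge0 ?(ltW N_gt0) // (inv_degs I).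
rewrite /bnd -natr1 !mulrDl mul1r; lra.
Qed.

(* Chebyshev's sum inequality: truncation commutes with the order, so the
   truncated degree of a uniform vertex is at most that of a size-biased one. *)
Lemma mean_min_le :
  n%:R^-1 * \sum_(k <- iota 0 n) md k <= mu.
Proof.
have n0 : 0 < n%:R :> R.
  rewrite ltr0n lt0n; apply/eqP => n0; move: N_gt0.
  by rewrite /N /deg_sum n0 big_ord0 ltxx.
rewrite /mu (sum_half_edges n d md).
rewrite ler_pdivrMl // mulrCA ler_pdivlMl //.
have NE : N = \sum_(k <- iota 0 n) (d k)%:R.
  by rewrite /N /deg_sum natr_sum -(big_mkord xpredT (fun k => (d k)%:R)) /index_iota subn0.
have : 0 <= \sum_(i <- iota 0 n) \sum_(j <- iota 0 n)
    ((d i)%:R - (d j)%:R) * (md i - md j).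
  apply: sumr_ge0 => i _; apply: sumr_ge0 => j _; rewrite /md.
  by case/orP: (le_total ((d i)%:R : R) (d j)%:R) => ij;
    [rewrite mulr_le0 ?subr_le0 //|rewrite mulr_ge0 ?subr_ge0 //];
    rewrite le_min !ge_min lexx ij ?orbT.
have nE : n%:R = \sum_(k <- iota 0 n) (1 : R).
  by rewrite big_const_seq count_predT size_iota iter_addr addr0.
have -> : \sum_(i <- iota 0 n) \sum_(j <- iota 0 n) ((d i)%:R - (d j)%:R) * (md i - md j) =
   2 * (n%:R * \sum_(i <- iota 0 n) md i *+ d i - N * \sum_(i <- iota 0 n) md i).
  transitivity (\sum_(i <- iota 0 n) (n%:R * (md i *+ d i) - N * md i -
     (d i)%:R * \sum_(j <- iota 0 n) md j + \sum_(j <- iota 0 n) md j *+ d j)).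
    apply: eq_bigr => i _; rewrite NE nE !big_distrl big_distrr /= -sumrB -sumrB -big_split.
    apply: eq_bigr => j _ /=.
    by rewrite -[md i *+ d i]mulr_natr -[md j *+ d j]mulr_natr; ring.
  rewrite big_split /= !sumrB -!big_distrr -big_distrl /= -NE.
  rewrite big_const_seq count_predT size_iota iter_addr addr0 -[X in _ + X]mulr_natl.
  ring.
by rewrite pmulr_rge0 // subr_ge0.
Qed.

(** The uniform root adds one more truncated degree, of mean at most [mu] by [mean_min_le]; hence
    [k.+1] in the last term. *)
Lemma ref_total_ge k :
  1 - k%:R * (B / N) - (k.+1%:R * mu) / B <= ref_total n d B K (fun=> 1) k.
Proof.
have n0 : 0 < n%:R :> R.
  rewrite ltr0n lt0n; apply/eqP => n0; move: N_gt0.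
  by rewrite /N /deg_sum n0 big_ord0 ltxx.
apply: (@le_trans _ _ (n%:R^-1 * \sum_(i <- iota 0 n) bnd k (md i))); last first.
  rewrite /ref_total ler_wpM2l ?invr_ge0 // [X in _ <= X]big_mkcond.
  rewrite big_seq [X in _ <= X]big_seq; apply: ler_sum => i.
  rewrite mem_iota add0n => /= il; case: ifP => iB.
    have := ref_value_ge k (inv_start il iB); rewrite /degs /= big_seq1.
    by have := @md_eq i 0 iB; rewrite add0n add0r => ->.
  apply: bnd_le0; have := @md_ge_B i 0; rewrite add0n add0r; apply.
  by rewrite ltNge iB.
have E i : bnd k (md i) = bnd k 0 - md i / B by rewrite /bnd !mulrDl; ring.
under eq_bigr do rewrite E.
rewrite sumrB big_const_seq count_predT size_iota iter_addr addr0 -mulr_suml mulrBr.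
have -> : n%:R^-1 * (bnd k 0 *+ n) = bnd k 0.
  by rewrite -[X in _ * X]mulr_natr mulrCA mulVf ?mulr1 // gt_eqF.
have h : n%:R^-1 * (\sum_(i <- iota 0 n) md i) / B <= mu / B.
  by rewrite ler_wpM2r ?invr_ge0 ?(ltW B_gt0) // mean_min_le.
by rewrite mulrA /bnd -natr1 add0r !mulrDl mul1r; lra.
Qed.

End ReferenceMass.

(** * Coupling of the two explorations *)

Section Coupling.
Variables (R : realType) (n : nat) (d : nat -> nat) (L : nat).
Variable K : expl -> option nat -> R.
Hypothesis HK : exploration_rule K.
Hypothesis N_even : ~~ odd (deg_sum n d).
Hypothesis N_gt0 : (0 < deg_sum n d)%N.
Let N : R := (deg_sum n d)%:R.

Let n_gt0 : (0 < n)%N.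
Proof.
by rewrite lt0n; apply/eqP => n0; move: N_gt0; rewrite /deg_sum n0 big_ord0.
Qed.

Let NR : 0 < N. Proof. by rewrite ltr0n. Qed.

Lemma prob_exploration (V : eqType) (v0 o : V) es : prob (exploration v0 es K L o).
Proof. by apply/prob_map/prob_explore. Qed.

Lemma prob_config : prob (config_exploration n d K L).
Proof.
apply: prob_bind => [|p _].
  apply: prob_unif; rewrite /pairings size_pairings ?half_edges_uniq //.
  by rewrite num_pairings_gt0 // size_half_edges.
apply: prob_bind => [|o _]; last exact: prob_exploration.
by apply: prob_unif; rewrite size_iota.
Qed.

Lemma prob_gw : prob (gw_exploration n d K L).
Proof.
apply: prob_bind => [|c _]; first exact: prob_law_D.
apply: prob_bind => [|t _]; last exact: prob_exploration.
exact/prob_gw_gen/prob_offs.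
Qed.

Lemma config_domination (B eta : R) f :
  (forall x, 0 <= f x) ->
  (forall x y, expl_agree x y -> expl_agree y x -> f x = f y) ->
  0 <= B -> 0 <= eta -> eta <= 1 -> B ^+ 2 <= eta * (N - B - 1) -> B + 1 <= N ->
  (1 - eta) * ref_total n d B K f L <= Ex (config_exploration n d K L) f.
Proof.
move=> f0 fi B0 eta0 eta1 BN B1.
have -> : Ex (config_exploration n d K L) f = Ex (cfg_law R n d)
    (fun w => Ex (exploration 0%N (pairing_edges w.1) K L w.2) f).
  rewrite /config_exploration /cfg_law !Ex_bind; apply: eq_Ex => p.
  by rewrite Ex_bind Ex_map.
apply: (@domination _ _ _ _ _ HK _ f0 fi _ _ _ _ _ snd (cfg_good n d) cfg_st cfg_gam
  (fun=> 1) (fun=> 1)) => //.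
- exact: nonneg_cfg_law.
- by move=> w k kn /and4P[_ /eqP /= <- _ _].
- move=> w; under eq_bigr do rewrite mul1r.
  apply: sum_unique_le1; first exact: iota_uniq.
  by move=> i j _ _ _ _ /and4P[_ /eqP /= <- _ _] /and4P[_ /eqP /= <- _ _].
- by move=> w r I g; exact: (cfg_matches I g).
- by move=> w r j I jl jo; rewrite /cfg_st /= map_rcons.
- by move=> w r j b; apply: cfg_reveal.
- by move=> w r j; apply: cfg_sum.
- by move=> r I _; apply: cfg_mass I.
Qed.

(** The branching side loses nothing. The free factor [rho] is there to be set to the [1 - eta] of
    the configuration side. *)
Lemma gw_domination (B rho : R) f :
  (forall x, 0 <= f x) ->
  (forall x y, expl_agree x y -> expl_agree y x -> f x = f y) ->
  rho <= 1 -> rho * ref_total n d B K f L <= Ex (gw_exploration n d K L) f.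
Proof.
move=> f0 fi rho1.
have -> : Ex (gw_exploration n d K L) f = Ex (gw_law R n d L)
    (fun t => Ex (exploration [::] t K L [::]) f).
  rewrite /gw_exploration /gw_law !Ex_bind; apply: eq_Ex => c.
  by rewrite Ex_bind.
apply: (@domination _ _ _ _ _ HK _ f0 fi _ _ _ _ _ (fun=> [::]) (gw_good d) gw_st gw_gam
  (gw_lam0 R n d) (gw_lam R n d)) => //.
- by have [] := prob_gw_law NR L.
- by move=> k; apply: gw_lam_ge0.
- by move=> k; apply: gw_lam0_ge0.
- by move=> t; apply: gw_root_sum.
- by move=> t r I g; exact: (gw_matches I g).
- by move=> w r j I jl jo; rewrite /gw_st /= map_rcons.
- by move=> t r j b I jl jo _ _; apply: gw_reveal I jl jo.
- by move=> t r j; apply: gw_sum.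
- move=> r I sL; apply: le_trans (gw_mass NR I sL).
  rewrite -mulrA ler_piMl // mulr_ge0 ?invr_ge0 // exprn_ge0 // invr_ge0 ltW //.
Qed.

(** Symmetrised by hand: [expl_agree_sym] asks for well-formedness, while [max_coupling] needs an
    equivalence relation on all of [expl]. *)
Definition agree2 x y := `[< expl_agree x y /\ expl_agree y x >].

(** The coupling is quantified before [B] and [eta]: it depends on the two laws only, so one
    coupling can later be tested against every choice of these parameters. *)
Lemma exploration_coupling : exists pi : dist R (expl * expl),
  is_coupling pi (config_exploration n d K L) (gw_exploration n d K L) /\
  forall B eta : R, 0 < B -> B <= Num.sqrt n%:R -> 0 <= eta -> eta <= 1 ->
    B ^+ 2 <= eta * (N - B - 1) -> B + 1 <= N ->
    (1 - eta) * (1 - L%:R * (B / N) - (L.+1%:R * mean_Dstar_min_sqrt R n d) / B)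
      <= agree_prob pi.
Proof.
have er : reflexive agree2 by move=> x; apply/asboolP; split; exact: expl_agree_refl.
have es : symmetric agree2.
  by move=> x y; apply/asboolP/asboolP => -[].
have et : transitive agree2.
  move=> y x z /asboolP[xy yx] /asboolP[yz zy]; apply/asboolP; split;
  by apply: expl_agree_trans; eassumption.
have [A [pi [Ae cpl le]]] := max_coupling er es et prob_config prob_gw.
exists pi; split=> // B eta B0 Bs eta0 eta1 BN B1.
have pi0 : nonneg pi by have [h _ _] := cpl; apply/allP.
apply: le_trans (_ : _ <= mass pi (fun q => agree2 q.1 q.2)) _; last first.
  rewrite /agree_prob !mass_Ex; apply: le_Ex => // q; rewrite ler_nat.
  by case h : (agree2 _ _) => //; move/asboolP: h => [h _]; rewrite asboolT.
apply: le_trans le.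
have inv_bool (C : pred bool) x y : expl_agree x y -> expl_agree y x ->
    (C (A x))%:R = (C (A y))%:R :> R.
  by move=> xy yx; rewrite (Ae x y) //; apply/asboolP.
(* The test functions are the indicators of [A] and of its complement. Their reference values add up
   to that of the constant 1, the survival probability. *)
have l1 := config_domination (f := fun x => (A x)%:R) (fun x => ler0n _ _)
  (inv_bool id) (ltW B0) eta0 eta1 BN B1.
have l2 := gw_domination (f := fun x => (~~ A x)%:R) B (rho := 1 - eta) (fun x => ler0n _ _)
  (inv_bool negb).
apply: le_trans (lerD l1 (l2 _)); last by rewrite gerBl.
rewrite -mulrDr -ref_totalD; apply: ler_wpM2l; first by rewrite subr_ge0.
rewrite (_ : (fun x => _) = (fun=> 1)); last first.
  by apply/funext => x; case: (A x); rewrite ?addr0 ?add0r.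
apply: le_trans (ref_total_ge HK NR B0 Bs L).
rewrite (_ : mean_Dstar_min_sqrt R n d = N^-1 * \sum_(h <- half_edges n d)
    Num.min (d h.1)%:R (Num.sqrt n%:R)) //.
rewrite (sum_half_edges n d (fun k => Num.min (d k)%:R (Num.sqrt n%:R))).
rewrite /mean_Dstar_min_sqrt; congr (_ * _).
rewrite -(big_mkord xpredT (fun k => (d k)%:R * Num.min (d k)%:R (Num.sqrt n%:R))).
by rewrite /index_iota subn0; apply: eq_bigr => k _; rewrite mulr_natl.
Qed.

End Coupling.

(** * Choice of constants and passage to the limit *)

(** A size-biased degree is at least 1. Consequently the assumption on [ell] also gives
    [ell = o(sqrt n)], which controls repeated labels. *)
Lemma mean_Dstar_min_sqrt_ge1 (R : realType) n d : (0 < deg_sum n d)%N ->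
  1 <= mean_Dstar_min_sqrt R n d.
Proof.
move=> N0; have NR : 0 < (deg_sum n d)%:R :> R by rewrite ltr0n.
rewrite /mean_Dstar_min_sqrt ler_pdivlMl // mulr1 /deg_sum natr_sum.
apply: ler_sum => k _; case dk : (d k) => [|m]; first by rewrite mul0r.
rewrite ler_peMr // le_min ler1n /= -[X in X <= _]sqrtr1 ler_sqrt ?ler01 //.
by rewrite ler1n; apply: leq_ltn_trans (ltn_ord k).
Qed.

(** Here [s] is [sqrt n] and [B] is [delta * s]. From [4 / c <= s] and [delta <= 1] one gets
    [B + 1 <= 2 * s <= c * s^2 / 2], so [N - B - 1] is at least [c * s^2 / 2]; then
    [delta <= eta * c / 2] makes [B^2] small enough. The two error terms are at most [eps' / c] and
    [2 * eps' / delta], whose sum is [eps] by the choice of [eps']. *)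
Lemma error_bound (R : realType) (c s N mu l eps eta delta eps' : R) :
  0 < c -> 0 < eta -> delta = Num.min 1 (eta * c / 2) ->
  eps' = eps / (c^-1 + 2 / delta) -> 0 < eps ->
  1 <= s -> 4 / c <= s -> c * s ^+ 2 <= N -> 1 <= mu -> 1 <= l -> l * mu <= eps' * s ->
  [/\ 0 < delta * s, delta * s <= s, (delta * s) ^+ 2 <= eta * (N - delta * s - 1),
      delta * s + 1 <= N & l * (delta * s / N) + ((l + 1) * mu) / (delta * s) <= eps].
Proof.
move=> c0 eta0 dE eE eps0 s1 sc cN mu1 l1 lmu.
have d0 : 0 < delta by rewrite dE lt_min ltr01 divr_gt0 ?mulr_gt0.
have d1 : delta <= 1 by rewrite dE ge_min lexx.
have dc : delta <= eta * c / 2 by rewrite dE ge_min lexx orbT.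
have s0 : 0 < s by lra.
have ds : delta * s <= s by rewrite ler_piMl // ltW.
have cs : 4 * s <= c * s ^+ 2.
  by rewrite expr2 mulrA ler_pM2r // mulrC -ler_pdivrMr.
have N0 : 0 < N by apply: lt_le_trans cN; rewrite mulr_gt0 ?exprn_gt0.
have half : c * s ^+ 2 / 2 <= N - delta * s - 1 by lra.
split=> //; first by rewrite mulr_gt0.
- apply: le_trans (_ : eta * (c * s ^+ 2 / 2) <= _); last by rewrite ler_pM2l.
  have -> : eta * (c * s ^+ 2 / 2) = (eta * c / 2) * s ^+ 2 by ring.
  rewrite exprMn ler_wpM2r ?sqr_ge0 //; apply: le_trans dc.
  by rewrite expr2 ler_piMl // ltW.
- by lra.
have e'0 : 0 < eps' by rewrite eE divr_gt0 // addr_gt0 ?invr_gt0 ?divr_gt0.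
have ->: eps = eps' / c + 2 * eps' / delta.
  have h : c^-1 + 2 / delta != 0 by rewrite gt_eqF // addr_gt0 ?invr_gt0 ?divr_gt0.
  have -> : eps' / c + 2 * eps' / delta = eps' * (c^-1 + 2 / delta) by ring.
  by rewrite eE divfK.
apply: lerD.
  rewrite mulrA ler_pdivrMr //; apply: le_trans (_ : eps' * s * s <= _).
    apply: ler_pM => //; first by lra.
      by rewrite ltW ?mulr_gt0.
    by apply: le_trans lmu; rewrite ler_peMr //; lra.
  apply: le_trans (_ : eps' / c * (c * s ^+ 2) <= _); last by rewrite ler_pM2l ?divr_gt0.
  by rewrite le_eqVlt; apply/orP; left; apply/eqP; field; rewrite gt_eqF.
rewrite ler_pdivrMr ?mulr_gt0 //.
have -> : 2 * eps' / delta * (delta * s) = 2 * (eps' * s) by field; rewrite gt_eqF.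
apply: le_trans (_ : 2 * (l * mu) <= _); last by rewrite ler_pM2l.
by rewrite mulrA ler_wpM2r //; lra.
Qed.

Unset Implicit Arguments.

Theorem theoremA1 (R : realType) (d : nat -> nat -> nat) (ell : nat -> nat)
  (K : nat -> expl -> option nat -> R) :
  (* N^(n) even and positive *)
  (forall n, (0 < n)%N -> ~~ odd (deg_sum n (d n)) && (0 < deg_sum n (d n))%N) ->
  (* liminf E[D_n] > 0 *)
  (exists c : R, 0 < c /\ exists M, forall n, (M <= n)%N ->
      c <= (deg_sum n (d n))%:R / n%:R) ->
  (* ell_n in N *)
  (forall n, (0 < n)%N -> (0 < ell n)%N) ->
  (* ell_n = o( sqrt n / E[D_n^* /\ sqrt n] ) *)
  (forall eps : R, 0 < eps -> exists M, forall n, (M <= n)%N ->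
      (ell n)%:R <= eps * (Num.sqrt (n%:R : R) / mean_Dstar_min_sqrt R n (d n))) ->
  (* (K_n) exploration rules *)
  (forall n, exploration_rule (K n)) ->
  exists pi : nat -> dist R (expl * expl),
    (forall n, (0 < n)%N ->
       is_coupling (pi n) (config_exploration n (d n) (K n) (ell n))
                          (gw_exploration n (d n) (K n) (ell n))) /\
    (forall eps : R, 0 < eps -> exists M, forall n, (M <= n)%N ->
       1 - eps <= agree_prob (pi n)).
Proof.
move=> dN [c [c0 [M1 cN]]] l0 lo HK.
(* The couplings are fixed before [eps] is given, so no diagonal argument is needed. For [n = 0] the
   empty list serves as a placeholder. *)
have /choice[pi Hpi] : forall n, exists pi : dist R (expl * expl), (0 < n)%N ->
    is_coupling pi (config_exploration n (d n) (K n) (ell n))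
      (gw_exploration n (d n) (K n) (ell n)) /\
    forall B eta : R, 0 < B -> B <= Num.sqrt n%:R -> 0 <= eta -> eta <= 1 ->
      B ^+ 2 <= eta * ((deg_sum n (d n))%:R - B - 1) -> B + 1 <= (deg_sum n (d n))%:R ->
      (1 - eta) * (1 - (ell n)%:R * (B / (deg_sum n (d n))%:R) -
        ((ell n).+1%:R * mean_Dstar_min_sqrt R n (d n)) / B) <= agree_prob pi.
  move=> n; have [n0|n0] := posnP n; first by exists [::]; rewrite n0.
  have /andP[dE d0] := dN n n0.
  by have [pi Hpi] := exploration_coupling (ell n) (HK n) dE d0; exists pi.
exists pi; split=> [n n0|eps eps0]; first by have [] := Hpi n n0.
(* Half of [eps] is spent on extra pairs in the configuration model, the other half on killing of
   the reference process. *)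
set eta : R := Num.min (eps / 2) 1.
have eta0 : 0 < eta by rewrite lt_min ltr01 divr_gt0.
have eta1 : eta <= 1 by rewrite ge_min lexx orbT.
have etae : eta <= eps / 2 by rewrite ge_min lexx.
set delta := Num.min 1 (eta * c / 2).
set eps' := (eps / 2) / (c^-1 + 2 / delta).
have d0 : 0 < delta by rewrite lt_min ltr01 divr_gt0 ?mulr_gt0.
have e0 : 0 < eps / 2 by rewrite divr_gt0.
have e'0 : 0 < eps' by rewrite divr_gt0 // addr_gt0 ?invr_gt0 ?divr_gt0.
have [M2 lM2] := lo eps' e'0.
(* The third term gives [(4 / c)^2 <= n], that is [4 / c <= sqrt n]; its successor also makes [n]
   positive. *)
exists (maxn (maxn M1 M2) (Num.bound ((4 / c) ^+ 2)).+1) => n.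
rewrite !geq_max -andbA => /and3P[n1 n2 n3].
have n0 : (0 < n)%N by lia.
have /andP[dE dp] := dN n n0; have [cpl agr] := Hpi n n0.
set N : R := (deg_sum n (d n))%:R in agr.
set mu := mean_Dstar_min_sqrt R n (d n) in agr.
have mu1 : 1 <= mu by apply: mean_Dstar_min_sqrt_ge1.
have mu0 : 0 < mu by apply: lt_le_trans mu1.
set s := Num.sqrt (n%:R : R) in agr.
have nR : 0 < n%:R :> R by rewrite ltr0n.
have s2 : s ^+ 2 = n%:R by rewrite sqr_sqrtr // ltW.
have s0 : 0 < s by rewrite sqrtr_gt0.
have s1 : 1 <= s by rewrite -[X in X <= _]sqrtr1 ler_sqrt ?ler1n.
have sc : 4 / c <= s.
  rewrite -(@ler_pXn2r _ 2) ?nnegrE ?(ltW s0) ?divr_ge0 ?(ltW c0) // s2.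
  apply: le_trans (ltW (archi_boundP _)) _; first by rewrite sqr_ge0.
  by rewrite ler_nat ltnW.
have cs : c * s ^+ 2 <= N by rewrite s2 -ler_pdivlMr //; apply: cN.
have l1 : 1 <= (ell n)%:R :> R by rewrite ler1n l0.
have lmu : (ell n)%:R * mu <= eps' * s.
  by rewrite -ler_pdivlMr // -mulrA; apply: lM2.
have [h1 h2 h3 h4 h5] := error_bound c0 eta0 erefl erefl e0 s1 sc cs mu1 l1 lmu.
apply: le_trans (agr _ eta h1 h2 (ltW eta0) eta1 h3 h4).
rewrite natr1 in h5; set x := _ * _ in h5; set y := _ / _ in h5.
have x0 : 0 <= x by rewrite /x !mulr_ge0 ?invr_ge0 ?ler0n ?(ltW d0) ?(ltW s0).
have y0 : 0 <= y.
  by rewrite /y divr_ge0 ?(ltW h1) // mulr_ge0 ?ler0n ?(ltW mu0).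
rewrite -/x -/y; have : 0 <= eta * (x + y) by rewrite mulr_ge0 ?(ltW eta0) ?addr_ge0.
by lra.
Qed.
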